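(* Let $H$ be a Hilbert space and let $A\subseteq B(H)$ be a subalgebra containing the identity operator $1$ (not necessarily self-adjoint), normed by the operator norm. If there is a diagonal in the Haagerup tensor product $A\otimes_h A$, then $A$ is finite dimensional.
   Context: For $w$ in the algebraic tensor product $A\otimes A$, the Haagerup norm is $\|w\|_h=\inf\{\|\sum_i a_ia_i^*\|^{1/2}\,\|\sum_i b_i^*b_i\|^{1/2}\}$, the infimum over all representations $w=\sum_i a_i\otimes b_i$ as finite sums of elementary tensors; $A\otimes_h A$ denotes the completion of $A\otimes A$ in this norm. The multiplication map $a\otimes b\mapsto ab$ extends to a contractive linear map $m$ from $A\otimes_h A$ into the norm closure of $A$ in $B(H)$, and for each $a\in A$ the maps $b\otimes c\mapsto ab\otimes c$ and $b\otimes c\mapsto b\otimes ca$ extend to bounded maps $u\mapsto a\cdot u$ and $u\mapsto u\cdot a$ on $A\otimes_h A$. A diagonal in $A\otimes_h A$ is an element $u\in A\otimes_h A$ with $m(u)=1$ and $a\cdot u=u\cdot a$ for every $a\in A$ (equivalently, $u=\sum_{i=1}^\infty a_i\otimes b_i$ norm convergent with $\sum_i a_ib_i=1$ and $\sum_i aa_i\otimes b_i=\sum_i a_i\otimes b_ia$ for all $a\in A$). *)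

(* Defs.v *)
From HB Require Import structures.
From mathcomp Require Import all_boot all_order all_algebra.
From mathcomp Require Import boolp classical_sets reals.
From mathcomp Require Import complex.
From Stdlib Require Import ClassicalEpsilon.

Set Implicit Arguments.
Unset Strict Implicit.
Unset Printing Implicit Defensive.

Import Order.TTheory GRing.Theory Num.Theory.
Local Open Scope ring_scope.
Local Open Scope classical_set_scope.

Definition hnorm (R : realType) (H : lmodType R[i]) (ip : H -> H -> R[i]) (x : H) : R :=
  Num.sqrt (@complex.Re R (ip x x)).

Definition is_inner_product (R : realType) (H : lmodType R[i]) (ip : H -> H -> R[i]) :=
  [/\ forall (k : R[i]) (x y z : H), ip (k *: x + y) z = k * ip x z + ip y z,
      forall x y : H, ip x y = conjc (ip y x),
      forall x : H, 0 <= ip x x &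
      forall x : H, ip x x = 0 -> x = 0].

Definition hcomplete (R : realType) (H : lmodType R[i]) (ip : H -> H -> R[i]) :=
  forall u : nat -> H,
    (forall e : R, 0 < e -> exists N : nat, forall m n : nat, (N <= m)%N -> (N <= n)%N ->
        hnorm ip (u m - u n) < e) ->
    exists l : H, forall e : R, 0 < e -> exists N : nat, forall n : nat, (N <= n)%N ->
        hnorm ip (u n - l) < e.

Definition is_hilbert (R : realType) (H : lmodType R[i]) (ip : H -> H -> R[i]) :=
  is_inner_product ip /\ hcomplete ip.

Section Ops.
Variables (R : realType) (H : lmodType R[i]).

Definition op := H -> H.
Definition opadd (S T : op) : op := fun x => S x + T x.
Definition opscale (k : R[i]) (T : op) : op := fun x => k *: T x.
Definition opmul (S T : op) : op := fun x => S (T x).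
Definition opid : op := fun x => x.
Definition opzero : op := fun _ => 0.

Definition is_linear_op (T : op) :=
  forall (k : R[i]) (x y : H), T (k *: x + y) = k *: T x + T y.

Variable ip : H -> H -> R[i].

Definition is_bounded_op (T : op) :=
  is_linear_op T /\ exists M : R, forall x, hnorm ip (T x) <= M * hnorm ip x.

Definition opnorm (T : op) : R :=
  sup [set r : R | exists x : H, hnorm ip x <= 1 /\ r = hnorm ip (T x)].

(* adjoint operator (chosen by classical choice; unique for bounded T) *)
Definition adj (T : op) : op :=
  epsilon (inhabits T) (fun S : op => forall x y : H, ip (T x) y = ip x (S y)).

Definition unital_subalgebra (A : set op) :=
  [/\ forall T, A T -> is_bounded_op T,
      A opid,
      forall S T, A S -> A T -> A (opadd S T),
      forall k T, A T -> A (opscale k T) &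
      forall S T, A S -> A T -> A (opmul S T)].

(* A finite tensor  sum_i a_i (x) b_i  is represented by the list of pairs (a_i, b_i). *)
Definition tensor := seq (op * op).

Definition in_A (A : set op) (w : tensor) := forall p, p \in w -> A p.1 /\ A p.2.

Definition bilinear_on (A : set op) (phi : op -> op -> R[i]) :=
  (forall k a1 a2 b, A a1 -> A a2 -> A b ->
     phi (opadd (opscale k a1) a2) b = k * phi a1 b + phi a2 b) /\
  (forall k a b1 b2, A a -> A b1 -> A b2 ->
     phi a (opadd (opscale k b1) b2) = k * phi a b1 + phi a b2).

(* two lists represent the same element of the algebraic tensor product A (x) A
   (the algebraic dual of A (x) A is the space of bilinear forms on A x A) *)
Definition same_tensor (A : set op) (v w : tensor) :=
  forall phi, bilinear_on A phi ->
    \sum_(p <- v) phi p.1 p.2 = \sum_(p <- w) phi p.1 p.2.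

Definition opsum (s : seq op) : op := foldr opadd opzero s.

Definition haag_rep (v : tensor) : R :=
  Num.sqrt (opnorm (opsum [seq opmul p.1 (adj p.1) | p <- v])) *
  Num.sqrt (opnorm (opsum [seq opmul (adj p.2) p.2 | p <- v])).

Definition haagerup (A : set op) (w : tensor) : R :=
  inf [set r : R | exists v : tensor, [/\ in_A A v, same_tensor A v w & r = haag_rep v]].

Definition tneg (w : tensor) : tensor := [seq (opscale (-1) p.1, p.2) | p <- w].
Definition tsub (v w : tensor) : tensor := v ++ tneg w.
Definition tmult (w : tensor) : op := opsum [seq opmul p.1 p.2 | p <- w].
Definition lact (a : op) (w : tensor) : tensor := [seq (opmul a p.1, p.2) | p <- w].
Definition ract (w : tensor) (a : op) : tensor := [seq (p.1, opmul p.2 a) | p <- w].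

(* An element u of A (x)_h A is given by a Haagerup-Cauchy sequence (w n) of
   finite tensors in A (x) A.  u is a diagonal iff m(u) = lim m(w n) = 1
   (m is contractive, so it extends continuously) and a.u = u.a for all a in A,
   i.e. || a.(w n) - (w n).a ||_h -> 0. *)
Definition has_diagonal (A : set op) :=
  exists w : nat -> tensor,
    [/\ forall n, in_A A (w n),
        (forall e : R, 0 < e -> exists N : nat, forall m n : nat, (N <= m)%N -> (N <= n)%N ->
            haagerup A (tsub (w n) (w m)) < e),
        (forall e : R, 0 < e -> exists N : nat, forall n : nat, (N <= n)%N ->
            opnorm (opadd (tmult (w n)) (opscale (-1) opid)) < e) &
        (forall a, A a -> forall e : R, 0 < e -> exists N : nat, forall n : nat, (N <= n)%N ->
            haagerup A (tsub (lact a (w n)) (ract (w n) a)) < e)].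

Definition finite_dim (A : set op) :=
  exists (n : nat) (f : 'I_n -> op), (forall i, A (f i)) /\
    forall T, A T -> exists c : 'I_n -> R[i], forall x : H, T x = \sum_(i < n) c i *: f i x.

End Ops.

(* Main.v *)
(** A diagonal is a series [u = sum_i a_i (x) b_i] whose row [(a_i)] is bounded and
    whose column [(b_i)] has small tails.  For vectors [xi, eta] and [c] in [A],
    the relation [c.u = u.c] makes [(sum_(i < K) <a_i xi, eta> b_i) c] close to
    [sum_(i < K) <c a_i xi, eta> b_i].  So the slice [sum_i <a_i xi, eta> b_i] almost
    kills every [c] on which the finitely many functionals [c |-> <c a_i xi, eta>],
    [i < K], vanish.

    The coefficient sequences [(<a_i xi, eta>)_i] span a subspace [L] of [l^2], and the
    row [(a_i)] vanishes on the orthogonal complement of [L].  With [q_1, ..., q_S] an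
    orthonormal family nearly exhausting [L] on the first coordinates this gives
    [1 ~ sum_s (sum_j conj (q_s(j)) a_j) (sum_i q_s(i) b_i)], where the second factors
    are finite combinations of slices.  Hence finitely many functionals separate the
    points of [A]. *)

Require Import Defs.
From mathcomp Require Import all_boot all_order all_algebra.
From mathcomp Require Import boolp classical_sets reals.
From mathcomp Require Import complex ring lra zify.
From Stdlib Require Import ClassicalEpsilon.

Set Implicit Arguments.
Unset Strict Implicit.
Unset Printing Implicit Defensive.

Import Order.TTheory GRing.Theory Num.Theory ComplexField.Normc.
Local Open Scope ring_scope.
Local Open Scope classical_set_scope.
Local Open Scope complex_scope.

(** * Complex numbers and inner products *)

Section ComplexNumbers.
Variable R : realType.
Implicit Types (z w : R[i]).

(** Cutting the series at [N] already brings the sum of the first [a_i b_i] close to [1], but a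
    single [b_i] is no slice, and the commutation relation says nothing about [b_i c]. The [q_s]
    repair this because they lie in [L] itself, not merely in its closure. Since [L] need not be
    closed, no projection onto it is available; but on [N] coordinates the energy of an orthonormal
    family is at most [N], so a nearly maximal family exists. Coordinates beyond [N] are absorbed by
    the column tail. The choices are ordered: [N] by the column tail, the accuracy [d] by the size
    of [b_i] for [i < N], then the family, then the commutation accuracy [k] by the number of
    slices, last the truncation [K]. All of them precede [c], so approximate commutation has to be
    made uniform in [c]. The errors add up to [‖c x‖ <= ‖c‖ ‖x‖ / 2], and such an inequality for all
    [x] forces [c = 0]. *)

Lemma normc_ge0 z : 0 <= normc z.
Proof. by case: z => a b; apply: sqrtr_ge0. Qed.

Lemma normc_sqr z : normc z ^+ 2 = complex.Re (z * conjc z).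
Proof.
case: z => a b /=; rewrite sqr_sqrtr ?addr_ge0 ?sqr_ge0 //; ring.
Qed.

Lemma mulc_conjc z : z * conjc z = (normc z ^+ 2)%:C.
Proof.
rewrite normc_sqr; case: z => a b /=; apply/eqP; rewrite eq_complex /= eqxx /=.
by apply/eqP; ring.
Qed.

Lemma normc_conjc z : normc (conjc z) = normc z.
Proof. by case: z => a b /=; rewrite sqrrN. Qed.

Lemma normc_real (r : R) : normc r%:C = `|r|.
Proof. by rewrite /= expr0n addr0 sqrtr_sqr. Qed.

Lemma normRe_le z : `|complex.Re z| <= normc z.
Proof.
case: z => a b /=; rewrite -sqrtr_sqr ler_wsqrtr // lerDl sqr_ge0 //.
Qed.

Lemma Re_le_normc z : complex.Re z <= normc z.
Proof. exact: le_trans (ler_norm _) (normRe_le z). Qed.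

Lemma conjcM z w : conjc (z * w) = conjc z * conjc w.
Proof. exact: rmorphM. Qed.

Lemma conjc_sum (I : Type) (r : seq I) (P : pred I) (F : I -> R[i]) :
  conjc (\sum_(i <- r | P i) F i) = \sum_(i <- r | P i) conjc (F i).
Proof. exact: (raddf_sum (@conjc R)). Qed.

Lemma ReD z w : complex.Re (z + w) = complex.Re z + complex.Re w.
Proof. by case: z; case: w. Qed.

Lemma Re_conjc z : complex.Re (conjc z) = complex.Re z.
Proof. by case: z. Qed.

Lemma Re_realM (r : R) z : complex.Re (r%:C * z) = r * complex.Re z.
Proof. by case: z => a b /=; rewrite mul0r subr0. Qed.

Lemma Re_sum (I : Type) (r : seq I) (P : pred I) (F : I -> R[i]) :
  complex.Re (\sum_(i <- r | P i) F i) = \sum_(i <- r | P i) complex.Re (F i).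
Proof. exact: (big_morph (@complex.Re R) ReD). Qed.

Lemma normc_sum (I : Type) (r : seq I) (P : pred I) (F : I -> R[i]) :
  normc (\sum_(i <- r | P i) F i) <= \sum_(i <- r | P i) normc (F i).
Proof.
elim/big_rec2: _ => [|i x y _ le_xy]; first by rewrite normc0.
by apply: le_trans (le_normcD _ _) _; rewrite lerD2l.
Qed.

Lemma sum_real_complex (I : Type) (r : seq I) (P : pred I) (F : I -> R) :
  \sum_(i <- r | P i) (F i)%:C = (\sum_(i <- r | P i) F i)%:C.
Proof. by rewrite (raddf_sum (real_complex R)). Qed.

Lemma sum_CauchySchwarz (I : Type) (r : seq I) (P : pred I) (u v : I -> R) :
  (\sum_(i <- r | P i) u i * v i) ^+ 2 <=
  (\sum_(i <- r | P i) u i ^+ 2) * (\sum_(i <- r | P i) v i ^+ 2).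
Proof.
set U := \sum_(i <- r | P i) u i ^+ 2; set V := \sum_(i <- r | P i) v i ^+ 2.
set W := \sum_(i <- r | P i) u i * v i.
have quad s t : 0 <= s ^+ 2 * U + 2 * s * t * W + t ^+ 2 * V.
  have -> : s ^+ 2 * U + 2 * s * t * W + t ^+ 2 * V =
      \sum_(i <- r | P i) (s * u i + t * v i) ^+ 2.
    rewrite /U /V /W !mulr_sumr -!big_split /=; apply: eq_bigr => i _; ring.
  by apply: sumr_ge0 => i _; apply: sqr_ge0.
have U0 : 0 <= U by apply: sumr_ge0 => i _; apply: sqr_ge0.
have V0 : 0 <= V by apply: sumr_ge0 => i _; apply: sqr_ge0.
(* If [U = 0], the pair [(V + 1, - W)] leaves [0 <= - (V + 2) W^2]; otherwise [(W, - U)] gives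
   [0 <= U (U V - W^2)]. *)
have := quad W (- U); have := quad 1 (- W); have := quad V (- W).
have := quad (V + 1) (- W).
have [->|U_neq0] := eqVneq U 0; first by nra.
have U_gt0 : 0 < U by rewrite lt_neqAle eq_sym U_neq0.
move=> _ _ _ h; rewrite -subr_ge0 -(pmulr_rge0 _ U_gt0).
by move: h; congr (0 <= _); ring.
Qed.

Lemma le_of_sqr_le_mul (x c : R) : 0 <= x -> 0 <= c -> x ^+ 2 <= c * x -> x <= c.
Proof.
move=> x0 c0; have [->//|xn] := eqVneq x 0.
by rewrite expr2 ler_pM2r // lt_neqAle eq_sym xn.
Qed.

End ComplexNumbers.

Section InnerProduct.
Variables (R : realType) (H : lmodType R[i]) (ip : H -> H -> R[i]).
Hypothesis ipP : is_inner_product ip.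
Local Notation "`‖ x ‖" := (hnorm ip x).

Lemma ip_linear k x y z : ip (k *: x + y) z = k * ip x z + ip y z.
Proof. by case: ipP. Qed.

Lemma ip_sym x y : ip x y = conjc (ip y x).
Proof. by case: ipP. Qed.

Lemma ipDl x y z : ip (x + y) z = ip x z + ip y z.
Proof. by have := ip_linear 1 x y z; rewrite scale1r mul1r. Qed.

Lemma ip0l z : ip 0 z = 0.
Proof. by apply: (@addIr _ (ip 0 z)); rewrite -ipDl !add0r. Qed.

Lemma ipZl k x z : ip (k *: x) z = k * ip x z.
Proof. by rewrite -[k *: x]addr0 ip_linear ip0l addr0. Qed.

Lemma ipNl x z : ip (- x) z = - ip x z.
Proof. by rewrite -scaleN1r ipZl mulN1r. Qed.

Lemma ipBl x y z : ip (x - y) z = ip x z - ip y z.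
Proof. by rewrite ipDl ipNl. Qed.

Lemma ip_suml (I : Type) (r : seq I) (P : pred I) (F : I -> H) z :
  ip (\sum_(i <- r | P i) F i) z = \sum_(i <- r | P i) ip (F i) z.
Proof. by apply: (big_morph (fun x => ip x z)) => [x y|]; rewrite ?ipDl ?ip0l. Qed.

Lemma ip_sumZl (I : Type) (r : seq I) (P : pred I) (c : I -> R[i]) (F : I -> H) z :
  ip (\sum_(i <- r | P i) c i *: F i) z = \sum_(i <- r | P i) c i * ip (F i) z.
Proof. by rewrite ip_suml; apply: eq_bigr => i _; rewrite ipZl. Qed.

Lemma ipDr x y z : ip z (x + y) = ip z x + ip z y.
Proof. by rewrite ip_sym ipDl rmorphD /= -!ip_sym. Qed.

Lemma ipZr k x z : ip z (k *: x) = conjc k * ip z x.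
Proof. by rewrite ip_sym ipZl rmorphM /= -!ip_sym. Qed.

Lemma ip0r z : ip z 0 = 0.
Proof. by rewrite ip_sym ip0l conjc0. Qed.

Lemma ipNr x z : ip z (- x) = - ip z x.
Proof. by rewrite ip_sym ipNl rmorphN /= -ip_sym. Qed.

Lemma ip_sumr (I : Type) (r : seq I) (P : pred I) (F : I -> H) z :
  ip z (\sum_(i <- r | P i) F i) = \sum_(i <- r | P i) ip z (F i).
Proof. by apply: (big_morph (ip z)) => [x y|]; rewrite ?ipDr ?ip0r. Qed.

Lemma hnorm_ge0 x : 0 <= `‖x‖.
Proof. exact: sqrtr_ge0. Qed.

Lemma hnorm_sqr x : `‖x‖ ^+ 2 = complex.Re (ip x x).
Proof.
rewrite sqr_sqrtr //; have [_ _ /(_ x) + _] := ipP.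
by rewrite lecE => /andP[].
Qed.

Lemma ip_self x : ip x x = (`‖x‖ ^+ 2)%:C.
Proof.
rewrite hnorm_sqr; have [_ _ /(_ x) + _] := ipP.
by rewrite lecE => /andP[/eqP + _]; case: (ip x x) => a b /= ->.
Qed.

Lemma hnorm_eq0 x : `‖x‖ = 0 -> x = 0.
Proof.
by move=> x0; have [_ _ _] := ipP; apply; rewrite ip_self x0 expr0n.
Qed.

Lemma hnorm0 : `‖0‖ = 0.
Proof. by rewrite /hnorm ip0l /= sqrtr0. Qed.

Lemma ip_eq x y : (forall z, ip x z = ip y z) -> x = y.
Proof.
move=> xy; apply/eqP; rewrite -subr_eq0; apply/eqP.
by have [_ _ _] := ipP; apply; rewrite ipBl xy subrr.
Qed.

Lemma hnormZ k x : `‖k *: x‖ = normc k * `‖x‖.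
Proof.
apply/eqP; rewrite -(@eqrXn2 _ 2) ?mulr_ge0 ?normc_ge0 ?hnorm_ge0 //.
rewrite exprMn !hnorm_sqr ipZl ipZr mulrA mulc_conjc.
by rewrite Re_realM.
Qed.

Lemma hnormN x : `‖- x‖ = `‖x‖.
Proof. by rewrite -scaleN1r hnormZ normcN normc1 mul1r. Qed.

Lemma hnormBC x y : `‖x - y‖ = `‖y - x‖.
Proof. by rewrite -hnormN opprB. Qed.

Lemma hnormD_sqr x y :
  `‖x + y‖ ^+ 2 = `‖x‖ ^+ 2 + 2 * complex.Re (ip x y) + `‖y‖ ^+ 2.
Proof.
rewrite !hnorm_sqr ipDl !ipDr !ReD (ip_sym y x) Re_conjc; ring.
Qed.

Lemma CauchySchwarz x y : normc (ip x y) <= `‖x‖ * `‖y‖.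
Proof.
have [x0|xn] := eqVneq `‖x‖ 0.
  by rewrite (hnorm_eq0 x0) ip0l normc0 mulr_ge0 ?hnorm_ge0.
have xp : 0 < `‖x‖ by rewrite lt_neqAle eq_sym xn hnorm_ge0.
rewrite -(@ler_pXn2r _ 2) ?nnegrE ?mulr_ge0 ?normc_ge0 ?hnorm_ge0 //.
(* This is the component of [y] orthogonal to [x], scaled by [‖x‖^2] to avoid a division. *)
have := sqr_ge0 `‖(`‖x‖ ^+ 2)%:C *: y + (- ip y x) *: x‖.
rewrite hnormD_sqr !hnormZ normcN ipZl ipZr.
set t := complex.Re _; rewrite normc_real ger0_norm ?sqr_ge0 //.
have -> : t = - (`‖x‖ ^+ 2 * normc (ip y x) ^+ 2).
  by rewrite /t normc_sqr -Re_realM rmorphN /=; case: (ip y x) => a b /=; ring.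
rewrite (ip_sym y x) normc_conjc => h.
have x2 : 0 < `‖x‖ ^+ 2 by rewrite exprn_gt0.
rewrite -subr_ge0 -(pmulr_rge0 _ x2); move: h; congr (0 <= _); ring.
Qed.

Lemma hnormD x y : `‖x + y‖ <= `‖x‖ + `‖y‖.
Proof.
rewrite -(@ler_pXn2r _ 2) ?nnegrE ?addr_ge0 ?hnorm_ge0 //.
rewrite hnormD_sqr.
have := le_trans (Re_le_normc _) (CauchySchwarz x y); nra.
Qed.

Lemma hnorm_sum (I : Type) (r : seq I) (P : pred I) (F : I -> H) :
  `‖\sum_(i <- r | P i) F i‖ <= \sum_(i <- r | P i) `‖F i‖.
Proof.
elim/big_rec2: _ => [|i x y _ le_xy]; first by rewrite hnorm0.
by apply: le_trans (hnormD _ _) _; rewrite lerD2l.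
Qed.

Lemma hnorm_sum_scale (I : Type) (r : seq I) (P : pred I)
    (c : I -> R[i]) (F : I -> H) :
  `‖\sum_(i <- r | P i) c i *: F i‖ ^+ 2 <=
  (\sum_(i <- r | P i) normc (c i) ^+ 2) * (\sum_(i <- r | P i) `‖F i‖ ^+ 2).
Proof.
apply: le_trans (sum_CauchySchwarz _ _ _ _).
rewrite ler_pXn2r ?nnegrE ?hnorm_ge0 ?sumr_ge0 // => [|i _]; last first.
  by rewrite mulr_ge0 ?normc_ge0 ?hnorm_ge0.
by apply: le_trans (hnorm_sum _ _ _) _; apply: ler_sum => i _; rewrite hnormZ.
Qed.

Lemma normc_sum_ip (I : Type) (r : seq I) (P : pred I) (x y : I -> H) :
  normc (\sum_(i <- r | P i) ip (x i) (y i)) ^+ 2 <=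
  (\sum_(i <- r | P i) `‖x i‖ ^+ 2) * (\sum_(i <- r | P i) `‖y i‖ ^+ 2).
Proof.
apply: le_trans (sum_CauchySchwarz _ _ _ _).
rewrite ler_pXn2r ?nnegrE ?normc_ge0 ?sumr_ge0 // => [|i _]; last first.
  by rewrite mulr_ge0 ?hnorm_ge0.
apply: le_trans (normc_sum _ _ _) _.
by apply: ler_sum => i _; apply: CauchySchwarz.
Qed.

Lemma hnorm_le_ip x c : 0 <= c -> (forall z, normc (ip x z) <= c * `‖z‖) ->
  `‖x‖ <= c.
Proof.
move=> c0 /(_ x); rewrite ip_self normc_real ger0_norm ?sqr_ge0 //.
by apply: le_of_sqr_le_mul; rewrite ?hnorm_ge0.
Qed.

End InnerProduct.

(** * Riesz representation and adjoints *)

Lemma invn_small (R : realType) (e : R) : 0 < e ->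
  exists N, forall n, (N <= n)%N -> n.+1%:R^-1 < e.
Proof.
move=> e0; exists (Num.truncn e^-1) => n le_n.
rewrite invf_plt ?posrE //; have := truncnS_gt e^-1.
by move/lt_le_trans; apply; rewrite ler_nat.
Qed.

Section Riesz.
Variables (R : realType) (H : lmodType R[i]) (ip : H -> H -> R[i]).
Hypothesis hilbP : is_hilbert ip.
Let ipP : is_inner_product ip := proj1 hilbP.
Local Notation "`‖ x ‖" := (hnorm ip x).

(* The representing vector minimises [‖x‖^2 - 2 Re (f x)]. *)
Lemma riesz (f : H -> R[i]) (M : R) :
  (forall k x y, f (k *: x + y) = k * f x + f y) ->
  (forall x, normc (f x) <= M * `‖x‖) ->
  exists z, forall x, f x = ip x z.
Proof.
move=> flin fM.
have fD x y : f (x + y) = f x + f y.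
  by have := flin 1 x y; rewrite scale1r mul1r.
have f0 : f 0 = 0 by apply: (@addIr _ (f 0)); rewrite -fD !add0r.
have fZ k x : f (k *: x) = k * f x by rewrite -[k *: x]addr0 flin f0 addr0.
pose q x := `‖x‖ ^+ 2 - 2 * complex.Re (f x).
pose E := [set r | exists x, r = q x].
have infE : has_inf E.
  split; first by exists (q 0), 0.
  exists (- M ^+ 2) => _ [x ->]; have := sqr_ge0 (`‖x‖ - M).
  have := le_trans (Re_le_normc _) (fM x); rewrite /q; nra.
pose m := inf E.
have mq x : m <= q x by apply: ge_inf; [case: infE | exists x].
have /choice[u uP] n : exists x, q x < m + n.+1%:R^-1.
  have [|_ [x ->] qx] := @inf_adherent _ E n.+1%:R^-1 _ infE.
    by rewrite invr_gt0.
  by exists x.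
(* Parallelogram law: [q] is at least [m] at the midpoint, so two near-minimisers are close. *)
have u_dist n k : `‖u n - u k‖ ^+ 2 <= 2 * n.+1%:R^-1 + 2 * k.+1%:R^-1.
  have := mq ((2^-1)%:C *: (u n + u k)); have := uP n; have := uP k.
  rewrite /q fZ Re_realM hnormZ // normc_real ger0_norm ?invr_ge0 //.
  rewrite fD ReD exprMn.
  have := hnormD_sqr ipP (u n) (u k); have := hnormD_sqr ipP (u n) (- u k).
  rewrite ipNr // hnormN // raddfN /=.
  rewrite mulrN => -> ->; rewrite (_ : 2^-1 ^+ 2 = 4^-1 :> R); last by field.
  by move: (n.+1%:R^-1) (k.+1%:R^-1) => ? ?; lra.
have [|l lP] := hilbP.2 u.
  move=> e e0; have e4 : 0 < e ^+ 2 / 4 by rewrite divr_gt0 ?exprn_gt0.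
  have [N NP] := invn_small e4; exists N => n k /NP nN /NP kN.
  rewrite -(@ltr_pXn2r _ 2) ?nnegrE ?hnorm_ge0 1?ltW //.
  apply: le_lt_trans (u_dist _ _) _.
  by move: nN kN; move: (n.+1%:R^-1) (k.+1%:R^-1) => ? ?; lra.
(* First variation at the minimiser. [q] is never evaluated at [l]: the bound [m <= q (u n + t h)]
   is compared with [q (u n) < m + 1/(n+1)], and only the cross term passes to the limit. *)
have lin0 h : complex.Re (ip l h) = complex.Re (f h).
  set g := complex.Re (ip l h) - complex.Re (f h).
  suff quad t : 0 <= t ^+ 2 * `‖h‖ ^+ 2 + 2 * t * g.
    have P0 := sqr_ge0 `‖h‖; set P := _ ^+ 2 in P0 quad.
    have := quad (- (g / (P + 1))).
    have -> : (- (g / (P + 1))) ^+ 2 * P + 2 * (- (g / (P + 1))) * g =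
        - ((g / (P + 1)) ^+ 2 * (P + 2)).
      by field; rewrite gt_eqF // ltr_wpDl.
    rewrite oppr_ge0 pmulr_lle0; last by rewrite ltr_wpDl.
    move=> h1; have : (g / (P + 1)) ^+ 2 == 0 by rewrite eq_le h1 sqr_ge0.
    rewrite expf_eq0 /= mulf_eq0 invr_eq0 (@gt_eqF _ _ (P + 1)) ?ltr_wpDl //.
    by rewrite orbF subr_eq0 => /eqP.
  suff key (e : R) : 0 < e -> 0 <= t ^+ 2 * `‖h‖ ^+ 2 + 2 * t * g + e.
    exact/ler_addgt0Pr.
  move=> e0.
  pose d : R := e / (2 * (2 * `|t| * `‖h‖ + 1)).
  have den0 : 0 < 2 * (2 * `|t| * `‖h‖ + 1).
    by rewrite mulr_gt0 // ltr_wpDl // !mulr_ge0 ?hnorm_ge0.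
  have d0 : 0 < d by rewrite divr_gt0.
  have [N1 N1P] := lP _ d0; have e2 : 0 < e / 2 by rewrite divr_gt0.
  have [N2 N2P] := invn_small e2; pose n := maxn N1 N2.
  have /ltW du := N1P n (leq_maxl _ _); have /ltW dn := N2P n (leq_maxr _ _).
  have := mq (u n + t%:C *: h); have := uP n.
  rewrite /q hnormD_sqr // ipZr // conjc_real Re_realM hnormZ // normc_real.
  rewrite fD fZ ReD Re_realM exprMn real_normK ?num_real //.
  have : `|t * complex.Re (ip (u n - l) h)| <= `|t| * `‖h‖ * d.
    rewrite normrM -mulrA ler_wpM2l // (le_trans (normRe_le _)) //.
    rewrite (le_trans (CauchySchwarz ipP _ _)) // mulrC ler_wpM2l ?hnorm_ge0 //.
  rewrite ipBl // ReD raddfN /= => /ler_normlP [h1 h2].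
  have : 2 * (`|t| * `‖h‖ * d) <= e / 2.
    have -> : e / 2 = d * (2 * `|t| * `‖h‖ + 1).
      by rewrite /d; field; rewrite gt_eqF // ltr_wpDl // !mulr_ge0 ?hnorm_ge0.
    by move: (ltW d0); clearbody d; move: (`|t|) (`‖h‖) => ? ?; lra.
  by rewrite /g; move: dn; move: (n.+1%:R^-1) => ?; lra.
exists l => x; rewrite (ip_sym ipP).
(* The instance at ['i *: x] supplies the imaginary parts. *)
have := lin0 x; have := lin0 ('i *: x).
rewrite ipZr // fZ; case: (ip l x) => a b; case: (f x) => c d /=.
move=> h1 ->; congr Complex; move: h1; lra.
Qed.

Lemma bounded_op_bound (T : op H) : is_bounded_op ip T ->
  exists2 M, 0 <= M & forall x, `‖T x‖ <= M * `‖x‖.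
Proof.
move=> [_ [M TM]]; exists `|M| => // x; apply: le_trans (TM x) _.
by rewrite ler_wpM2r ?hnorm_ge0 ?ler_norm.
Qed.

(** Riesz, applied to [x |-> <T x, y>], shows that the choice made in [adj] has a witness. Later
    facts on adjoints, linearity included, rest on this identity. *)
Lemma adjP (T : op H) : is_bounded_op ip T ->
  forall x y, ip (T x) y = ip x (adj ip T y).
Proof.
move=> bT; apply: (epsilon_spec (inhabits T)
  (fun S : op H => forall x y, ip (T x) y = ip x (S y))).
have [M M0 TM] := bounded_op_bound bT.
have /choice[S SP] y : exists z, forall x, ip (T x) y = ip x z.
  apply: (@riesz _ (M * `‖y‖)) => [k x z|x].
    by rewrite bT.1 ip_linear.
  apply: le_trans (CauchySchwarz ipP _ _) _.
  by rewrite mulrAC ler_wpM2r ?hnorm_ge0.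
by exists S.
Qed.

Lemma adj_linear (T : op H) : is_bounded_op ip T -> is_linear_op (adj ip T).
Proof.
move=> bT k x y; apply: (ip_eq ipP) => z.
rewrite (ip_sym ipP) -adjP // ip_linear // (ip_sym ipP (adj _ _ x)).
by rewrite (ip_sym ipP (adj _ _ y)) -!adjP // ipDr // ipZr // rmorphD rmorphM /= conjcK.
Qed.

Lemma adj_bound (T : op H) (M : R) : is_bounded_op ip T -> 0 <= M ->
  (forall x, `‖T x‖ <= M * `‖x‖) -> forall x, `‖adj ip T x‖ <= M * `‖x‖.
Proof.
move=> bT M0 TM x; apply: (hnorm_le_ip ipP); first by rewrite mulr_ge0 ?hnorm_ge0.
move=> z; rewrite ip_sym // normc_conjc -adjP //.
apply: le_trans (CauchySchwarz ipP _ _) _.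
by rewrite mulrAC ler_wpM2r ?hnorm_ge0.
Qed.

Lemma adj_bounded (T : op H) : is_bounded_op ip T -> is_bounded_op ip (adj ip T).
Proof.
move=> bT; split; first exact: adj_linear.
by have [M M0 TM] := bounded_op_bound bT; exists M; apply: adj_bound.
Qed.

Lemma linear_op0 (T : op H) : is_linear_op T -> T 0 = 0.
Proof.
move=> TL; have := TL 1 0 0; rewrite !scale1r addr0.
by move=> /(congr1 (fun z => z - T 0)); rewrite addrK subrr.
Qed.

Lemma linear_opZ (T : op H) k x : is_linear_op T -> T (k *: x) = k *: T x.
Proof. by move=> TL; rewrite -[k *: x]addr0 TL linear_op0 // addr0. Qed.

Lemma linear_opD (T : op H) x y : is_linear_op T -> T (x + y) = T x + T y.
Proof. by move=> TL; have := TL 1 x y; rewrite !scale1r. Qed.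

Lemma linear_op_sum (T : op H) (I : Type) (r : seq I) (P : pred I) (F : I -> H) :
  is_linear_op T -> T (\sum_(i <- r | P i) F i) = \sum_(i <- r | P i) T (F i).
Proof.
by move=> TL; apply: (big_morph T) => [x y|]; rewrite ?linear_opD ?linear_op0.
Qed.

Lemma opnorm_bound (T : op H) : is_bounded_op ip T ->
  forall x, `‖T x‖ <= opnorm ip T * `‖x‖.
Proof.
move=> bT x; have [M M0 TM] := bounded_op_bound bT.
have [x0|xn] := eqVneq `‖x‖ 0.
  by apply: le_trans (TM x) _; rewrite x0 !mulr0.
have xp : 0 < `‖x‖ by rewrite lt_neqAle eq_sym xn hnorm_ge0.
rewrite -ler_pdivrMr //; apply: ub_le_sup.
  exists M => _ [y [y1 ->]]; apply: le_trans (TM y) _.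
  by rewrite ler_piMr.
exists ((`‖x‖^-1)%:C *: x); rewrite (linear_opZ _ _ bT.1) !hnormZ // normc_real ger0_norm ?invr_ge0 ?hnorm_ge0 //.
by rewrite mulVf // lexx mulrC.
Qed.

Lemma opnorm_ge0 (T : op H) : is_bounded_op ip T -> 0 <= opnorm ip T.
Proof.
move=> bT; have [M M0 TM] := bounded_op_bound bT.
apply: le_trans (hnorm_ge0 ip (T 0)) _; apply: ub_le_sup.
  exists M => _ [y [y1 ->]]; apply: le_trans (TM y) _.
  by rewrite ler_piMr.
by exists 0; rewrite hnorm0.
Qed.

Lemma opnorm_le (T : op H) M : 0 <= M -> (forall x, `‖T x‖ <= M * `‖x‖) ->
  opnorm ip T <= M.
Proof.
move=> M0 TM; apply: ge_sup; first by exists `‖T 0‖, 0; rewrite hnorm0.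
by move=> _ [y [y1 ->]]; apply: le_trans (TM y) _; rewrite ler_piMr.
Qed.

Lemma bounded_opmul (S T : op H) :
  is_bounded_op ip S -> is_bounded_op ip T -> is_bounded_op ip (opmul S T).
Proof.
move=> bS bT; split; first by move=> k x y; rewrite /opmul bT.1 bS.1.
have [M M0 SM] := bounded_op_bound bS; have [N N0 TN] := bounded_op_bound bT.
exists (M * N) => x; apply: le_trans (SM _) _.
by rewrite -mulrA ler_wpM2l.
Qed.

Lemma bounded_opadd (S T : op H) :
  is_bounded_op ip S -> is_bounded_op ip T -> is_bounded_op ip (opadd S T).
Proof.
move=> bS bT; split.
  by move=> k x y; rewrite /opadd bT.1 bS.1 scalerDr addrACA.
have [M M0 SM] := bounded_op_bound bS; have [N N0 TN] := bounded_op_bound bT.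
exists (M + N) => x; apply: le_trans (hnormD ipP _ _) _.
by rewrite mulrDl lerD.
Qed.

Lemma bounded_opzero : is_bounded_op ip (@opzero R H).
Proof.
split; first by move=> k x y; rewrite /opzero scaler0 addr0.
by exists 0 => x; rewrite hnorm0 // mul0r.
Qed.

Lemma bounded_opscale k (T : op H) :
  is_bounded_op ip T -> is_bounded_op ip (opscale k T).
Proof.
move=> bT; split.
  by move=> l x y; rewrite /opscale bT.1 scalerDr !scalerA mulrC.
have [M M0 TM] := bounded_op_bound bT; exists (normc k * M) => x.
by rewrite hnormZ // -mulrA ler_wpM2l ?normc_ge0.
Qed.

Lemma bounded_opid : is_bounded_op ip (@opid R H).
Proof. by split=> //; exists 1 => x; rewrite mul1r. Qed.

Lemma opsumE (s : seq (op H)) x : opsum s x = \sum_(T <- s) T x.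
Proof. by elim: s => [|T s IH]; rewrite ?big_nil // big_cons /= /opadd IH. Qed.

Lemma bounded_opsum (I : eqType) (r : seq I) (F : I -> op H) :
  {in r, forall i, is_bounded_op ip (F i)} ->
  is_bounded_op ip (opsum [seq F i | i <- r]).
Proof.
elim: r => [|i r IH] bF; first exact: bounded_opzero.
apply: bounded_opadd; first by apply: bF; rewrite mem_head.
by apply: IH => j jr; apply: bF; rewrite inE jr orbT.
Qed.

End Riesz.

(** * Finite tensors and the Haagerup norm *)

Section Tensors.
Variables (R : realType) (H : lmodType R[i]) (ip : H -> H -> R[i]).
Hypothesis hilbP : is_hilbert ip.
Let ipP : is_inner_product ip := proj1 hilbP.
Variable A : set (op H).
Hypothesis AP : unital_subalgebra ip A.
Local Notation "`‖ x ‖" := (hnorm ip x).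
Implicit Types (v w : tensor H).

Lemma alg_bounded T : A T -> is_bounded_op ip T.
Proof. by case: AP => + _ _ _ _; apply. Qed.

Lemma alg_linear T : A T -> is_linear_op T.
Proof. by case/alg_bounded. Qed.

Lemma alg_scale k T : A T -> A (opscale k T).
Proof. by case: AP => _ _ _ + _; apply. Qed.

Lemma alg_add S T : A S -> A T -> A (opadd S T).
Proof. by case: AP => _ _ + _ _; apply. Qed.

Lemma alg_mul S T : A S -> A T -> A (opmul S T).
Proof. by case: AP => _ _ _ _; apply. Qed.

Lemma alg_zero : A (@opzero R H).
Proof.
have -> : @opzero R H = opscale 0 (@opid R H).
  by apply: funext => x; rewrite /opscale scale0r.
by apply: alg_scale; case: AP.
Qed.

Lemma opscale_add0 k (T : op H) : opscale k T = opadd (opscale k T) (@opzero R H).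
Proof. by apply: funext => x; rewrite /opadd addr0. Qed.

Section Bilinear.
Variable phi : op H -> op H -> R[i].
Hypothesis phiP : bilinear_on A phi.

Lemma bilinear0l b : A b -> phi (@opzero R H) b = 0.
Proof.
move=> Ab; have := phiP.1 1 (@opzero R H) (@opzero R H) b alg_zero alg_zero Ab.
rewrite -opscale_add0 mul1r (_ : opscale 1 _ = @opzero R H); last first.
  by apply: funext => x; rewrite /opscale scaler0.
by move=> /(congr1 (fun z => z - phi (@opzero R H) b)); rewrite addrK subrr.
Qed.

Lemma bilinear0r a : A a -> phi a (@opzero R H) = 0.
Proof.
move=> Aa; have := phiP.2 1 a (@opzero R H) (@opzero R H) Aa alg_zero alg_zero.
rewrite -opscale_add0 mul1r (_ : opscale 1 _ = @opzero R H); last first.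
  by apply: funext => x; rewrite /opscale scaler0.
by move=> /(congr1 (fun z => z - phi a (@opzero R H))); rewrite addrK subrr.
Qed.

Lemma bilinearZl k a b : A a -> A b -> phi (opscale k a) b = k * phi a b.
Proof.
move=> Aa Ab; rewrite opscale_add0 phiP.1 ?bilinear0l ?addr0 //.
exact: alg_zero.
Qed.

Lemma bilinearZr k a b : A a -> A b -> phi a (opscale k b) = k * phi a b.
Proof.
move=> Aa Ab; rewrite opscale_add0 phiP.2 ?bilinear0r ?addr0 //.
exact: alg_zero.
Qed.

Lemma bilinear_tsub v w : in_A A w ->
  \sum_(p <- tsub v w) phi p.1 p.2 =
  \sum_(p <- v) phi p.1 p.2 - \sum_(p <- w) phi p.1 p.2.
Proof.
move=> Aw; rewrite big_cat big_map -sumrN; congr (_ + _).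
rewrite !big_seq; apply: eq_bigr => p /Aw[Ap Aq].
by rewrite bilinearZl // mulN1r.
Qed.

End Bilinear.

Lemma in_A_tsub v w : in_A A v -> in_A A w -> in_A A (tsub v w).
Proof.
move=> Av Aw p; rewrite mem_cat => /orP[/Av//|/mapP[q /Aw[? ?] ->]].
by split=> //; apply: alg_scale.
Qed.

Lemma in_A_lact c v : A c -> in_A A v -> in_A A (lact c v).
Proof. by move=> Ac Av p /mapP[q /Av[? ?] ->]; split=> //; apply: alg_mul. Qed.

Lemma in_A_ract c v : A c -> in_A A v -> in_A A (ract v c).
Proof. by move=> Ac Av p /mapP[q /Av[? ?] ->]; split=> //; apply: alg_mul. Qed.

(** [same_tensor] tests scalar bilinear forms only, so slices are handled through their pairings
    with [zeta]. Taking [c] to be the identity or an element of [A] covers both sides of the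
    commutation relation. *)
Lemma slice_bilinear c xi eta x zeta : is_linear_op c ->
  bilinear_on A (fun a b => ip (c (a xi)) eta * ip (b x) zeta).
Proof.
move=> cL; split=> [k a1 a2 b Aa1 Aa2 Ab|k a b1 b2 Aa Ab1 Ab2].
  by rewrite /opadd /opscale cL ip_linear //; ring.
by rewrite /opadd /opscale ip_linear //; ring.
Qed.

Lemma slice_vec_bilinear c xi eta x zeta : is_linear_op c ->
  bilinear_on A (fun a b => ip (ip (c (a xi)) eta *: b x) zeta).
Proof.
move=> cL; have := slice_bilinear xi eta x zeta cL.
rewrite (_ : (fun a b => _ * _) = (fun a b => ip (ip (c (a xi)) eta *: b x) zeta)) //.
by apply/funext => a; apply/funext => b; rewrite ipZl.
Qed.

Lemma mult_bilinear x zeta : bilinear_on A (fun a b => ip (a (b x)) zeta).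
Proof.
split=> [k a1 a2 b Aa1 Aa2 Ab|k a b1 b2 Aa Ab1 Ab2].
  by rewrite /opadd /opscale ip_linear.
by rewrite /opadd /opscale (alg_linear Aa) ip_linear.
Qed.

Lemma same_tensor_vec (psi : op H -> op H -> H) v w : same_tensor A v w ->
  (forall zeta, bilinear_on A (fun a b => ip (psi a b) zeta)) ->
  \sum_(p <- v) psi p.1 p.2 = \sum_(p <- w) psi p.1 p.2.
Proof.
move=> vw psiP; apply: (ip_eq ipP) => z; rewrite !ip_suml //.
exact: vw (psiP z).
Qed.

(** Quadratic-form reading of [sum_p a_p a_p^* <= e], and [col_bound] likewise of
    [sum_p b_p^* b_p <= e]. In this form the bounds add up under concatenation of lists. *)
Definition row_bound v (e : R) :=
  forall z, \sum_(p <- v) `‖adj ip p.1 z‖ ^+ 2 <= e * `‖z‖ ^+ 2.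

Definition col_bound v (e : R) :=
  forall x, \sum_(p <- v) `‖p.2 x‖ ^+ 2 <= e * `‖x‖ ^+ 2.

Lemma row_bound_opnorm v : in_A A v ->
  row_bound v (opnorm ip (opsum [seq opmul p.1 (adj ip p.1) | p <- v])).
Proof.
move=> Av z; set S := opsum _.
have bS : is_bounded_op ip S.
  apply: bounded_opsum => // p /Av[/alg_bounded bp _].
  by apply: bounded_opmul => //; apply: adj_bounded.
have -> : \sum_(p <- v) `‖adj ip p.1 z‖ ^+ 2 = complex.Re (ip (S z) z).
  rewrite /S opsumE big_map ip_suml // Re_sum !big_seq.
  apply: eq_bigr => p /Av[/alg_bounded bp _].
  by rewrite /opmul adjP // -hnorm_sqr.
apply: le_trans (Re_le_normc _) _; apply: le_trans (CauchySchwarz ipP _ _) _.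
by rewrite expr2 mulrA ler_wpM2r ?hnorm_ge0 ?opnorm_bound.
Qed.

Lemma col_bound_opnorm v : in_A A v ->
  col_bound v (opnorm ip (opsum [seq opmul (adj ip p.2) p.2 | p <- v])).
Proof.
move=> Av x; set S := opsum _.
have bS : is_bounded_op ip S.
  apply: bounded_opsum => // p /Av[_ /alg_bounded bp].
  by apply: bounded_opmul => //; apply: adj_bounded.
have -> : \sum_(p <- v) `‖p.2 x‖ ^+ 2 = complex.Re (ip (S x) x).
  rewrite /S opsumE big_map ip_suml // Re_sum !big_seq.
  apply: eq_bigr => p /Av[_ /alg_bounded bp].
  by rewrite /opmul (ip_sym ipP) -adjP // -ip_sym // -hnorm_sqr.
apply: le_trans (Re_le_normc _) _; apply: le_trans (CauchySchwarz ipP _ _) _.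
by rewrite expr2 mulrA ler_wpM2r ?hnorm_ge0 ?opnorm_bound.
Qed.

Lemma adj_opscale (t : R) (T : op H) z : is_bounded_op ip T ->
  adj ip (opscale t%:C T) z = t%:C *: adj ip T z.
Proof.
move=> bT; apply: (ip_eq ipP) => y; rewrite (ip_sym ipP) (ip_sym ipP (_ *: _)).
congr conjc; rewrite -adjP //; last exact: bounded_opscale.
by rewrite ipZl // ipZr // conjc_real adjP.
Qed.

(** The Haagerup norm controls only the product of row and column norms. Replacing [(a, b)] by
    [(t a, t^-1 b)] keeps the tensor and shares the bound between the two sides. *)
Lemma haagerup_balanced w (e : R) : in_A A w -> haagerup ip A w < e ->
  exists v, [/\ in_A A v, same_tensor A v w, row_bound v e & col_bound v e].
Proof.
move=> Aw we.
have infP : has_inf [set r : R | exists v : tensor H,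
    [/\ in_A A v, same_tensor A v w & r = haag_rep ip v]].
  split; first by exists (haag_rep ip w), w; split.
  by exists 0 => _ [v [_ _ ->]]; rewrite mulr_ge0 ?sqrtr_ge0.
have [|_ [v [Av vw ->]]] := @inf_adherent _ _ (e - haagerup ip A w) _ infP.
  by rewrite subr_gt0.
rewrite -/(haagerup ip A w) addrC subrK /haag_rep.
have := row_bound_opnorm Av; have := col_bound_opnorm Av.
set X := opnorm ip (opsum [seq opmul p.1 (adj ip p.1) | p <- v]).
set Y := opnorm _ _ => colY rowX.
have X0 : 0 <= X.
  apply: opnorm_ge0 => //; apply: bounded_opsum => // p /Av[/alg_bounded bp _].
  by apply: bounded_opmul => //; apply: adj_bounded.
have Y0 : 0 <= Y.
  apply: opnorm_ge0 => //; apply: bounded_opsum => // p /Av[_ /alg_bounded bp].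
  by apply: bounded_opmul => //; apply: adj_bounded.
move=> XYe; have e0 : 0 < e by apply: le_lt_trans XYe; rewrite mulr_ge0 ?sqrtr_ge0.
have XYe2 : X * Y <= e ^+ 2.
  rewrite -(sqr_sqrtr X0) -(sqr_sqrtr Y0) -exprMn.
  by rewrite ler_pXn2r ?nnegrE ?mulr_ge0 ?sqrtr_ge0 //; apply: ltW.
have [t t0 [tX tY]] : exists2 t, 0 < t & t ^+ 2 * X <= e /\ t^-1 ^+ 2 * Y <= e.
  have [X_eq0|Xn] := eqVneq X 0.
    (* The row costs nothing here, so [t] need only be large; [Y + 1] keeps it positive when
       [Y = 0]. *)
    have Z0 : 0 < (Y + 1) / e by rewrite divr_gt0 // ltr_wpDl.
    exists (Num.sqrt ((Y + 1) / e)); first by rewrite sqrtr_gt0.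
    rewrite X_eq0 mulr0 exprVn sqr_sqrtr ?(ltW Z0) // invf_div.
    split; first exact: ltW.
    rewrite mulrAC ler_pdivrMr ?ltr_wpDl //.
    by rewrite ler_pM2l // lerDl.
  have Xp : 0 < X by rewrite lt_neqAle eq_sym Xn.
  (* Then [t^2 X = e] exactly, and [t^-2 Y = X Y / e <= e]. *)
  exists (Num.sqrt (e / X)); first by rewrite sqrtr_gt0 divr_gt0.
  rewrite exprVn sqr_sqrtr ?divr_ge0 ?(ltW e0) // invf_div divfK ?lexx //.
  by split=> //; rewrite mulrAC ler_pdivrMr // -expr2.
exists [seq (opscale t%:C p.1, opscale (t^-1)%:C p.2) | p <- v]; split.
- by move=> p /mapP[q /Av[? ?] ->]; split; apply: alg_scale.
- move=> phi phiP; rewrite big_map -(vw phi phiP) !big_seq.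
  apply: eq_bigr => p /Av[Ap Aq] /=.
  rewrite (bilinearZl phiP) ?(bilinearZr phiP) //; last exact: alg_scale.
  by rewrite mulrA -rmorphM /= mulfV ?mul1r // gt_eqF.
- move=> z; rewrite big_map /=.
  apply: le_trans (ler_wpM2r (sqr_ge0 _) tX); rewrite -mulrA.
  apply: le_trans (ler_wpM2l (sqr_ge0 t) (rowX z)); rewrite mulr_sumr.
  rewrite !big_seq; apply: ler_sum => p /Av[/alg_bounded bp _].
  by rewrite adj_opscale // hnormZ // normc_real exprMn real_normK ?num_real.
- move=> z; rewrite big_map /=.
  apply: le_trans (ler_wpM2r (sqr_ge0 _) tY); rewrite -mulrA.
  apply: le_trans (ler_wpM2l (sqr_ge0 _) (colY z)); rewrite mulr_sumr.
  apply: ler_sum => p _.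
  by rewrite /opscale hnormZ // normc_real exprMn real_normK ?num_real.
Qed.

(** Cauchy-Schwarz separates the two legs: the coefficients [<xi, a_p^* eta>] are controlled by the
    row, the vectors [b_p x] by the column. *)
Lemma slice_bound v e xi eta x : in_A A v -> 0 <= e ->
  row_bound v e -> col_bound v e ->
  `‖\sum_(p <- v) ip (p.1 xi) eta *: p.2 x‖ <= e * (`‖xi‖ * `‖eta‖ * `‖x‖).
Proof.
move=> Av e0 rv cv.
rewrite -(@ler_pXn2r _ 2) ?nnegrE ?mulr_ge0 ?hnorm_ge0 //.
apply: le_trans (hnorm_sum_scale ipP _ _ _ _) _.
have -> : (e * (`‖xi‖ * `‖eta‖ * `‖x‖)) ^+ 2 =
   (`‖xi‖ ^+ 2 * (e * `‖eta‖ ^+ 2)) * (e * `‖x‖ ^+ 2) by ring.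
apply: ler_pM; rewrite ?sumr_ge0 //; try by move=> i _; apply: sqr_ge0.
apply: le_trans (ler_wpM2l (sqr_ge0 _) (rv eta)); rewrite mulr_sumr.
rewrite !big_seq; apply: ler_sum => p /Av[/alg_bounded bp _].
rewrite adjP // -exprMn ler_pXn2r ?nnegrE ?mulr_ge0 ?hnorm_ge0 ?normc_ge0 //.
exact: CauchySchwarz.
Qed.

End Tensors.

(** * Series representation of a diagonal *)

Section DiagonalSeries.
Variables (R : realType) (H : lmodType R[i]) (ip : H -> H -> R[i]).
Hypothesis hilbP : is_hilbert ip.
Let ipP : is_inner_product ip := proj1 hilbP.
Variable A : set (op H).
Hypothesis AP : unital_subalgebra ip A.
Local Notation "`‖ x ‖" := (hnorm ip x).

(** The factor of [c] is the exact sum of [2^-i] over [k <= i < k + j], which lets the induction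
    close. It serves with [k = 0] for the global row bound and with large [k] for small column
    tails. *)
Lemma geometric_block_sum (T : eqType) (t : nat -> seq T) (f : T -> R) (c : R) k :
  (forall k, exists2 s, t k.+1 = t k ++ s & \sum_(p <- s) f p <= 2^-1 ^+ k * c) ->
  forall j, \sum_(p <- t (k + j)%N) f p <=
    \sum_(p <- t k) f p + (2 * 2^-1 ^+ k - 2 * 2^-1 ^+ (k + j)) * c.
Proof.
move=> tS; elim=> [|j IH]; first by rewrite addn0 subrr mul0r addr0.
rewrite addnS; have [s -> sc] := tS (k + j)%N; rewrite big_cat /= exprS.
by apply: le_trans (lerD IH sc) _; lra.
Qed.

(** [ds_mult] and [ds_comm] speak of some arbitrarily large truncations [K], because the
    construction identifies partial sums as tensors only at the ends of blocks. In [ds_comm] this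
    [K] may depend on [c] and [x], whereas [ds_col] and [ds_mult] are uniform in the vector. *)
Record diagonal_series (a b : nat -> op H) (alpha : R) : Prop := DiagonalSeries {
  ds_inl : forall i, A (a i);
  ds_inr : forall i, A (b i);
  ds_ge0 : 0 <= alpha;
  ds_row : forall K z,
    \sum_(0 <= i < K) `‖adj ip (a i) z‖ ^+ 2 <= alpha * `‖z‖ ^+ 2;
  ds_col : forall e, 0 < e -> exists N, forall K x,
    \sum_(N <= i < K) `‖b i x‖ ^+ 2 <= e * `‖x‖ ^+ 2;
  ds_mult : forall e K0, 0 < e -> exists2 K, (K0 <= K)%N & forall x,
    `‖\sum_(0 <= i < K) a i (b i x) - x‖ <= e * `‖x‖;
  ds_comm : forall c xi eta x e K0, A c -> 0 < e -> exists2 K, (K0 <= K)%N &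
    `‖\sum_(0 <= i < K) ip (a i xi) eta *: b i (c x) -
      \sum_(0 <= i < K) ip (c (a i xi)) eta *: b i x‖ <= e }.

Lemma tmult_bound (w : tensor H) e x : in_A A w ->
  opnorm ip (opadd (tmult w) (opscale (-1) (@opid R H))) < e ->
  `‖\sum_(p <- w) p.1 (p.2 x) - x‖ <= e * `‖x‖.
Proof.
move=> Aw we; set S := opadd _ _ in we.
have bS : is_bounded_op ip S.
  apply: bounded_opadd => //; last by apply: bounded_opscale => //; apply: bounded_opid.
  apply: bounded_opsum => // p /Aw[Ap Aq].
  by apply: (alg_bounded AP); apply: (alg_mul AP).
have -> : \sum_(p <- w) p.1 (p.2 x) - x = S x.
  by rewrite /S /opadd /tmult opsumE big_map /opscale scaleN1r.
apply: le_trans (opnorm_bound hilbP bS x) _.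
by rewrite ler_wpM2r ?hnorm_ge0 ?ltW.
Qed.

(** A slice does not depend on the representative, so [c.w - w.c] may be replaced by a balanced one,
    to which [slice_bound] applies. *)
Lemma commutator_bound (w : tensor H) c e xi eta x : in_A A w -> A c -> 0 <= e ->
  haagerup ip A (tsub (lact c w) (ract w c)) < e ->
  `‖\sum_(p <- w) ip (p.1 xi) eta *: p.2 (c x) -
    \sum_(p <- w) ip (c (p.1 xi)) eta *: p.2 x‖ <= e * (`‖xi‖ * `‖eta‖ * `‖x‖).
Proof.
move=> Aw Ac e0; have Al := in_A_lact AP Ac Aw; have Ar := in_A_ract AP Ac Aw.
move=> /(haagerup_balanced hilbP AP (in_A_tsub AP Al Ar)) [v [Av vw rv cv]].
rewrite hnormBC //.
apply: le_trans (slice_bound hilbP AP xi eta x Av e0 rv cv).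
suff -> : \sum_(p <- w) ip (c (p.1 xi)) eta *: p.2 x -
  \sum_(p <- w) ip (p.1 xi) eta *: p.2 (c x) =
  \sum_(p <- v) ip (p.1 xi) eta *: p.2 x by [].
apply: (ip_eq ipP) => z; rewrite ipBl // !(ip_sumZl ipP).
have bil := @slice_bilinear R H ip hilbP A id xi eta x z (fun k x y => erefl).
by rewrite (vw _ bil) (bilinear_tsub AP bil) // !big_map.
Qed.

(** A subsequence with successive Haagerup distances below [2^-k] is telescoped; balanced
    representatives of the differences are the blocks of the series. *)
Lemma diagonal_series_exists : has_diagonal ip A ->
  exists a b alpha, diagonal_series a b alpha.
Proof.
move=> [w [Aw cauchy mult comm]].
have half_gt0 k : 0 < 2^-1 ^+ k :> R by rewrite exprn_gt0 // invr_gt0.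
have /choice[Nf NfP] k : exists N, forall m n, (N <= m)%N -> (N <= n)%N ->
    haagerup ip A (tsub (w n) (w m)) < 2^-1 ^+ k by apply: cauchy.
(* The sum makes [m] monotone and at least [Nf k]; the summand [k] makes it unbounded. *)
pose m k := (\sum_(0 <= j < k.+1) Nf j + k)%N.
have mS k : (m k <= m k.+1)%N.
  by rewrite /m [X in (_ <= X + _)%N]big_nat_recr //=; lia.
have mN k : (Nf k <= m k)%N by rewrite /m big_nat_recr //=; lia.
have km k : (k <= m k)%N by rewrite leq_addl.
have /choice[s sP] k : exists s, [/\ in_A A s,
    same_tensor A s (tsub (w (m k.+1)) (w (m k))),
    row_bound ip s (2^-1 ^+ k) & col_bound ip s (2^-1 ^+ k)].
  apply: haagerup_balanced => //; first exact (in_A_tsub AP (Aw _) (Aw _)).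
  by apply: NfP; [exact: mN | exact: leq_trans (mN k) (mS k)].
(* A representative may be the empty list. A zero pair at the head of every block ensures
   [k < size (T k)], so that entry [i] of the series can be read off from [T i]. *)
pose z0 : op H * op H := (@opzero R H, @opzero R H).
pose T := fix T k := if k is k'.+1 then T k' ++ z0 :: s k' else z0 :: w (m 0%N).
have Az0 : A z0.1 /\ A z0.2 by split; apply: (alg_zero AP).
have AT k : in_A A (T k).
  elim: k => [|k IH] p; first by rewrite inE => /orP[/eqP->|/Aw].
  rewrite mem_cat inE => /or3P[/IH//|/eqP-> //|].
  by have [As _ _ _] := sP k; move/As.
have phi0 phi : bilinear_on A phi -> phi z0.1 z0.2 = 0.
  by move=> phiP; apply: (bilinear0l AP) => //; apply: (alg_zero AP).
have Tw k : same_tensor A (T k) (w (m k)).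
  elim: k => [|k IH] phi phiP; first by rewrite big_cons phi0 // add0r.
  rewrite big_cat big_cons /= (phi0 phi phiP) add0r IH //; have [_ sk _ _] := sP k.
  by rewrite sk // (bilinear_tsub AP phiP) // addrC subrK.
have sizeT k : (k < size (T k))%N.
  by elim: k => // k IH /=; rewrite size_cat /=; lia.
have nthT k j i : (i < size (T k))%N -> nth z0 (T (k + j)%N) i = nth z0 (T k) i.
  elim: j => [|j IH] ik; first by rewrite addn0.
  rewrite addnS /= nth_cat IH //; case: ifP => // /negbT.
  suff -> : (i < size (T (k + j)))%N by [].
  apply: leq_trans ik _; elim: j {IH} => [|j IH]; first by rewrite addn0.
  by rewrite addnS /= size_cat; lia.
pose p i := nth z0 (T i) i.
have pT k i : (i < size (T k))%N -> p i = nth z0 (T k) i.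
  move=> ik; rewrite /p; have [le_ik|lt_ki] := leqP i k.
    by rewrite -(subnKC le_ik) nthT.
  by rewrite -(subnKC (ltnW lt_ki)) nthT //; rewrite subnKC // ltnW.
have sumT (V : nmodType) (F : op H * op H -> V) k :
    \sum_(0 <= i < size (T k)) F (p i) = \sum_(q <- T k) F q.
  by rewrite (big_nth z0); apply: eq_big_nat => i /andP[_ ik]; rewrite (pT k).
have Ap i : A (p i).1 /\ A (p i).2 by apply: (AT i); rewrite mem_nth.
have adj0 z : `‖adj ip (@opzero R H) z‖ ^+ 2 = 0.
  have -> : adj ip (@opzero R H) z = 0.
    apply: (ip_eq ipP) => y; rewrite (ip_sym ipP) -adjP //.
      by rewrite !ip0l // conjc0.
    exact: bounded_opzero.
  by rewrite hnorm0 // expr0n.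
have sq0 (V : H) : 0 <= `‖V‖ ^+ 2 by apply: sqr_ge0.
have monoT (f : op H * op H -> R) K : (forall q, 0 <= f q) ->
    \sum_(0 <= i < K) f (p i) <= \sum_(q <- T K) f q.
  move=> f0; rewrite -sumT (@big_cat_nat _ _ _ K 0 (size (T K))) //=.
    by rewrite lerDl sumr_ge0.
  exact: ltnW.
exists (fun i => (p i).1), (fun i => (p i).2).
(* The [2] is the sum of the row bounds [2^-k] of all blocks [s k]. *)
exists (opnorm ip (opsum [seq opmul q.1 (adj ip q.1) | q <- T 0%N]) + 2).
split.
- by move=> i; case: (Ap i).
- by move=> i; case: (Ap i).
- rewrite addr_ge0 // opnorm_ge0 //; apply: bounded_opsum => // q /AT[/(alg_bounded AP) bq _].
  by apply: bounded_opmul => //; apply: adj_bounded.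
- move=> K z.
  apply: le_trans (@monoT (fun q => `‖adj ip q.1 z‖ ^+ 2) K _) _ => //.
  have tS k : exists2 t, T k.+1 = T k ++ t &
      \sum_(q <- t) `‖adj ip q.1 z‖ ^+ 2 <= 2^-1 ^+ k * `‖z‖ ^+ 2.
    exists (z0 :: s k) => //; rewrite big_cons /= adj0 add0r.
    by have [_ _ + _] := sP k; apply.
  have := geometric_block_sum 0 tS K; rewrite add0n => /le_trans; apply.
  rewrite [leRHS]mulrDl lerD //; first exact: (row_bound_opnorm hilbP AP (AT 0%N)).
  by rewrite ler_wpM2r // expr0 mulr1 lerBlDr lerDl mulr_ge0 ?ltW.
- move=> e e0.
  (* The left-hand side bounds the total column weight of the blocks appended after [T k]. *)
  have [k ke] : exists k, 2 * 2^-1 ^+ k <= e.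
    have [k /(_ k (leqnn k)) ke] := invn_small (divr_gt0 e0 (ltr0n _ 2)).
    exists k; rewrite mulrC -ler_pdivlMr // ltW // (le_lt_trans _ ke) //.
    rewrite exprVn lef_pV2 ?posrE ?exprn_gt0 // -natrX ler_nat.
    exact: ltn_expl.
  exists (size (T k)) => K x.
  have [le_K|lt_K] := leqP K (size (T k)); first by rewrite big_geq // mulr_ge0 // ltW.
  rewrite -(lerD2l (\sum_(0 <= i < size (T k)) `‖(p i).2 x‖ ^+ 2)).
  rewrite -big_cat_nat //=; last exact: ltnW.
  apply: le_trans (@monoT (fun q => `‖q.2 x‖ ^+ 2) K _) _ => //.
  have kK : (k <= K)%N by apply: ltnW; apply: leq_ltn_trans lt_K; apply: ltnW.
  rewrite -(subnKC kK) (sumT _ (fun q => `‖q.2 x‖ ^+ 2)).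
  apply: le_trans (@geometric_block_sum _ T _ (`‖x‖ ^+ 2) k _ _) _.
    move=> j; exists (z0 :: s j) => //; rewrite big_cons /= hnorm0 // expr0n add0r.
    by have [_ _ _] := sP j; apply.
  rewrite lerD2l ler_wpM2r // (le_trans _ ke) // lerBlDr lerDl.
  by rewrite mulr_ge0 ?ltW.
(* [m k >= k >= N] puts [w (m k)] in the good range, and [size (T k) > k >= K0] makes the truncation
   long enough. *)
- move=> e K0 e0; have [N NP] := mult e e0; pose k := (K0 + N)%N.
  exists (size (T k)); first by apply: ltnW; apply: leq_ltn_trans (sizeT k); lia.
  move=> x; rewrite (sumT _ (fun q => q.1 (q.2 x))).
  rewrite (same_tensor_vec hilbP (psi := fun a b => a (b x)) (Tw k)); last first.
    by move=> zeta; apply: mult_bilinear.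
  apply: tmult_bound => //; apply: NP; apply: leq_trans (km k).
  exact: leq_addl.
- move=> c xi eta x e K0 Ac e0.
  pose d := `‖xi‖ * `‖eta‖ * `‖x‖.
  have d0 : 0 <= d by rewrite !mulr_ge0 ?hnorm_ge0.
  have ed : 0 < e / (d + 1) by rewrite divr_gt0 // ltr_wpDl.
  have [N NP] := comm c Ac _ ed; pose k := (K0 + N)%N.
  exists (size (T k)); first by apply: ltnW; apply: leq_ltn_trans (sizeT k); lia.
  rewrite (sumT _ (fun q => ip (q.1 xi) eta *: q.2 (c x))).
  rewrite (sumT _ (fun q => ip (c (q.1 xi)) eta *: q.2 x)).
  rewrite (same_tensor_vec hilbP (psi := fun a b => ip (a xi) eta *: b (c x)) (Tw k)); last first.
    by move=> zeta; apply: (@slice_vec_bilinear R H ip hilbP A id).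
  rewrite (same_tensor_vec hilbP (psi := fun a b => ip (c (a xi)) eta *: b x) (Tw k)); last first.
    by move=> zeta; apply: (slice_vec_bilinear hilbP); apply: (alg_linear AP).
  apply: le_trans (commutator_bound _ _ _ _ Ac (ltW ed) (NP _ _)) _ => //.
    by apply: leq_trans (km k); apply: leq_addl.
  rewrite -/d mulrAC ler_pdivrMr ?ltr_wpDl // ler_pM2l //.
  by rewrite lerDl.
Qed.

End DiagonalSeries.

(** * Square-summable sequences *)

Section ComplexLimits.
Variable R : realType.
Implicit Types (u v : nat -> R[i]) (k l : R[i]).

Definition ccvg u l := forall e : R, 0 < e ->
  exists N, forall K, (N <= K)%N -> normc (u K - l) <= e.

Lemma ccvg_unique u l l' : ccvg u l -> ccvg u l' -> l = l'.
Proof.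
move=> ul ul'; apply/eqP; rewrite -subr_eq0; apply/eqP/eq0_normc.
apply/eqP; rewrite eq_le normc_ge0 andbT; apply/ler_addgt0Pr => e e0.
have e2 : 0 < e / 2 by rewrite divr_gt0.
have [N NP] := ul _ e2; have [N' NP'] := ul' _ e2.
have := NP _ (leq_maxl N N'); have := NP' _ (leq_maxr N N').
set K := maxn N N' => h1 h2; rewrite add0r.
rewrite (_ : l - l' = (u K - l') + - (u K - l)); last by ring.
apply: le_trans (le_normcD _ _) _; rewrite normcN.
by rewrite [leRHS](splitr e) lerD.
Qed.

Lemma ccvgD u v l l' : ccvg u l -> ccvg v l' -> ccvg (fun K => u K + v K) (l + l').
Proof.
move=> ul vl e e0; have e2 : 0 < e / 2 by rewrite divr_gt0.
have [N NP] := ul _ e2; have [N' NP'] := vl _ e2.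
exists (maxn N N') => K; rewrite geq_max => /andP[/NP h1 /NP' h2].
rewrite opprD addrACA; apply: le_trans (le_normcD _ _) _.
by rewrite [leRHS](splitr e) lerD.
Qed.

Lemma ccvgZ k u l : ccvg u l -> ccvg (fun K => k * u K) (k * l).
Proof.
move=> ul e e0; have ek : 0 < e / (normc k + 1).
  by rewrite divr_gt0 // ltr_wpDl ?normc_ge0.
have [N NP] := ul _ ek; exists N => K /NP h.
rewrite -mulrBr normcM; apply: le_trans (ler_wpM2l (normc_ge0 k) h) _.
rewrite mulrA ler_pdivrMr ?ltr_wpDl ?normc_ge0 // mulrC ler_pM2l //.
by rewrite lerDl.
Qed.

Lemma ccvg_conj u l : ccvg u l -> ccvg (fun K => conjc (u K)) (conjc l).
Proof.
move=> ul e e0; have [N NP] := ul _ e0; exists N => K /NP.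
by rewrite -rmorphB normc_conjc.
Qed.

Lemma ccvg_eq u v l : (forall K, u K = v K) -> ccvg u l -> ccvg v l.
Proof. by move=> uv ul e /ul[N NP]; exists N => K /NP; rewrite uv. Qed.

Lemma ccvg_cst l : ccvg (fun=> l) l.
Proof. by move=> e e0; exists 0%N => K _; rewrite subrr normc0 ltW. Qed.

Lemma ccvg_sum (I : Type) (r : seq I) (f : I -> nat -> R[i]) (g : I -> R[i]) :
  (forall i, ccvg (f i) (g i)) ->
  ccvg (fun K => \sum_(i <- r) f i K) (\sum_(i <- r) g i).
Proof.
move=> fg; elim: r => [|i r IH].
  by rewrite big_nil; apply: ccvg_eq (ccvg_cst 0) => K; rewrite big_nil.
rewrite big_cons; apply: ccvg_eq (ccvgD (fg i) IH) => K.
by rewrite big_cons.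
Qed.

Lemma ccvg_normc_le u l x (M : R) N : ccvg u l ->
  (forall K, (N <= K)%N -> normc (u K - x) <= M) -> normc (l - x) <= M.
Proof.
move=> ul uM; apply/ler_addgt0Pr => e e0; have [N' NP] := ul _ e0.
have := NP _ (leq_maxl N' N); have := uM _ (leq_maxr N' N).
set K := maxn _ _ => h1 h2.
rewrite (_ : l - x = (u K - x) + - (u K - l)); last by ring.
by apply: le_trans (le_normcD _ _) _; rewrite normcN lerD.
Qed.

Lemma ccvg_nondecreasing_le (f : nat -> R) l :
  (forall m n, (m <= n)%N -> f m <= f n) -> ccvg (fun K => (f K)%:C) l ->
  forall K, f K <= complex.Re l.
Proof.
move=> fmono fl K; apply/ler_addgt0Pr => e e0; have [N NP] := fl _ e0.
have := NP _ (leq_maxl N K); move/(le_trans (normRe_le _)).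
rewrite ReD raddfN /= => /ler_normlP[_]; rewrite lerBlDl => h.
by rewrite (le_trans (fmono _ _ (leq_maxr N K))).
Qed.

Lemma ccvg_Re_le (f : nat -> R) l M :
  (forall K, f K <= M) -> ccvg (fun K => (f K)%:C) l -> complex.Re l <= M.
Proof.
move=> fM fl; apply/ler_addgt0Pr => e e0; have [N NP] := fl _ e0.
have := NP _ (leqnn N); move/(le_trans (normRe_le _)).
rewrite ReD raddfN /= => /ler_normlP[+ _]; rewrite opprB lerBlDr => h.
by rewrite (le_trans h) // addrC lerD2r.
Qed.

Lemma bounded_nondecreasing_ccvg (f : nat -> R) M :
  (forall m n, (m <= n)%N -> f m <= f n) -> (forall K, f K <= M) ->
  exists l : R, ccvg (fun K => (f K)%:C) l%:C.
Proof.
move=> fmono fM; pose E := [set f K | K in setT].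
have supE : has_sup E.
  by split; [exists (f 0%N), 0%N | exists M => _ [K _ <-]].
exists (sup E) => e e0; have [_ [N _ <-] fN] := sup_adherent e0 supE.
exists N => K NK; rewrite -rmorphB normc_real distrC ger0_norm.
  rewrite lerBlDr -lerBlDl (le_trans (ltW fN)) // fmono //.
by rewrite subr_ge0; apply: ub_le_sup; [case: supE | exists K].
Qed.

End ComplexLimits.

Section SquareSummable.
Variable R : realType.
Implicit Types (u v w : nat -> R[i]).

Definition partial_ip u v K : R[i] := \sum_(0 <= i < K) u i * conjc (v i).

Definition square_summable u :=
  exists M : R, forall K, \sum_(0 <= i < K) normc (u i) ^+ 2 <= M.

Definition l2ip u v : R[i] := epsilon (inhabits 0) (ccvg (partial_ip u v)).

Definition l2sqr u : R := complex.Re (l2ip u u).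

Lemma partial_ip_self u K :
  partial_ip u u K = (\sum_(0 <= i < K) normc (u i) ^+ 2)%:C.
Proof. by rewrite -sum_real_complex; apply: eq_bigr => i _; rewrite mulc_conjc. Qed.

Lemma sum_nat_nondecreasing (f : nat -> R) : (forall i, 0 <= f i) ->
  forall m n, (m <= n)%N -> \sum_(0 <= i < m) f i <= \sum_(0 <= i < n) f i.
Proof.
move=> f0 m n mn; rewrite (big_cat_nat (leq0n m) mn) /= lerDl.
by apply: sumr_ge0.
Qed.

Lemma square_summable_lin k u v : square_summable u -> square_summable v ->
  square_summable (fun i => k * u i + v i).
Proof.
move=> [M uM] [N vN]; exists (2 * (normc k ^+ 2 * M) + 2 * N) => K.
apply: le_trans (lerD (ler_wpM2l (ler0n _ 2) (ler_wpM2l (sqr_ge0 (normc k)) (uM K)))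
  (ler_wpM2l (ler0n _ 2) (vN K))).
rewrite !mulr_sumr -big_split; apply: ler_sum => i _ /=.
rewrite -exprMn -normcM; set x := k * u i.
have := le_normcD x (v i); have := sqr_ge0 (normc x - normc (v i)).
have := normc_ge0 (x + v i); have := normc_ge0 x; have := normc_ge0 (v i).
move: (normc x) (normc (v i)) (normc (x + v i)) => p q r p0 q0 r0 h1 h2.
have : r ^+ 2 <= (p + q) ^+ 2 by rewrite ler_pXn2r ?nnegrE ?addr_ge0.
nra.
Qed.

(** Polarization: the squared norms of [k v + u], for the four units [k], have bounded nondecreasing
    partial sums, hence limits. Their combination is the witness for the choice in [l2ip]. *)
Lemma l2ip_ccvg u v : square_summable u -> square_summable v ->
  ccvg (partial_ip u v) (l2ip u v).
Proof.
move=> su sv; apply: epsilon_spec.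
have norm_ccvg w : square_summable w -> exists l : R, ccvg (partial_ip w w) l%:C.
  move=> [M wM]; have [||l lP] := @bounded_nondecreasing_ccvg R
    (fun K => \sum_(0 <= i < K) normc (w i) ^+ 2) M => //.
    by apply: sum_nat_nondecreasing => i; apply: sqr_ge0.
  by exists l; apply: ccvg_eq lP => K; rewrite partial_ip_self.
pose w k i := k * v i + u i.
have /choice[l lP] k : exists l : R, ccvg (partial_ip (w k) (w k)) l%:C.
  by apply: norm_ccvg; apply: square_summable_lin.
exists (4^-1 * (1 * (l 1)%:C + -1 * (l (-1))%:C + 'i * (l 'i)%:C + - 'i * (l (- 'i))%:C)).
apply: ccvg_eq (ccvgZ _ (ccvgD (ccvgD (ccvgD (ccvgZ _ (lP _)) (ccvgZ _ (lP _)))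
  (ccvgZ _ (lP _))) (ccvgZ _ (lP _)))) => K.
rewrite /partial_ip !mulr_sumr -!big_split /= mulr_sumr; apply: eq_bigr => i _.
rewrite /w !rmorphD !rmorphM /=; case: (u i) => a b; case: (v i) => c d.
rewrite -[4^-1](_ : (4^-1)%:C = _); last by rewrite fmorphV rmorph_nat.
by apply/eqP; rewrite eq_complex /=; apply/andP; split; apply/eqP; field.
Qed.

End SquareSummable.

(** * Almost complete orthonormal families *)

Section Orthonormal.
Variables (R : realType) (L : set (nat -> R[i])).
Hypothesis L0 : L (fun=> 0).
Hypothesis Llin : forall k u v, L u -> L v -> L (fun i => k * u i + v i).
Hypothesis Lsq : forall u, L u -> square_summable u.
Implicit Types (u v w : nat -> R[i]) (q : nat -> nat -> R[i]).

Lemma l2ip_cvg u v : L u -> L v -> ccvg (partial_ip u v) (l2ip u v).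
Proof. by move=> /Lsq su /Lsq; apply: l2ip_ccvg. Qed.

Lemma l2ip_linear k u v w : L u -> L v -> L w ->
  l2ip (fun i => k * u i + v i) w = k * l2ip u w + l2ip v w.
Proof.
move=> Lu Lv Lw; apply: ccvg_unique (l2ip_cvg (Llin k Lu Lv) Lw) _.
apply: ccvg_eq (ccvgD (ccvgZ k (l2ip_cvg Lu Lw)) (l2ip_cvg Lv Lw)) => K.
rewrite /partial_ip mulr_sumr -big_split; apply: eq_bigr => i _ /=; ring.
Qed.

Lemma l2ip_sym u v : L u -> L v -> l2ip u v = conjc (l2ip v u).
Proof.
move=> Lu Lv; apply: ccvg_unique (l2ip_cvg Lu Lv) _.
apply: ccvg_eq (ccvg_conj (l2ip_cvg Lv Lu)) => K.
by rewrite conjc_sum; apply: eq_bigr => i _; rewrite conjcM conjcK mulrC.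
Qed.

Lemma l2ip0l w : L w -> l2ip (fun=> 0) w = 0.
Proof.
move=> Lw; apply: ccvg_unique (l2ip_cvg L0 Lw) _.
apply: ccvg_eq (ccvg_cst 0) => K.
by rewrite /partial_ip big1 // => i _; rewrite mul0r.
Qed.

Lemma l2sqr_ge_partial u K : L u -> \sum_(0 <= i < K) normc (u i) ^+ 2 <= l2sqr u.
Proof.
move=> Lu; apply: (@ccvg_nondecreasing_le R
  (fun K => \sum_(0 <= i < K) normc (u i) ^+ 2)).
  by apply: sum_nat_nondecreasing => i; apply: sqr_ge0.
by apply: ccvg_eq (l2ip_cvg Lu Lu) => K'; rewrite partial_ip_self.
Qed.

Lemma l2sqr_ge_coord u i : L u -> normc (u i) ^+ 2 <= l2sqr u.
Proof.
move=> Lu; apply: le_trans (l2sqr_ge_partial i.+1 Lu).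
by rewrite big_nat_recr //= lerDr sumr_ge0 // => j _; apply: sqr_ge0.
Qed.

Lemma l2sqr_ge0 u : L u -> 0 <= l2sqr u.
Proof. by move=> Lu; apply: le_trans (l2sqr_ge_coord 0 Lu); apply: sqr_ge0. Qed.

Lemma l2sqr_le u M : L u ->
  (forall K, \sum_(0 <= i < K) normc (u i) ^+ 2 <= M) -> l2sqr u <= M.
Proof.
move=> Lu uM; apply: (@ccvg_Re_le R _ _ _ uM).
by apply: ccvg_eq (l2ip_cvg Lu Lu) => K'; rewrite partial_ip_self.
Qed.

Lemma l2ip_self u : L u -> l2ip u u = (l2sqr u)%:C.
Proof.
move=> Lu; have := l2ip_sym Lu Lu; rewrite /l2sqr; case: (l2ip u u) => a b [] /= h.
by apply/eqP; rewrite eq_complex /= eqxx /=; apply/eqP; lra.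
Qed.

Definition comb S (c : nat -> R[i]) q : nat -> R[i] :=
  fun i => \sum_(s < S) c s * q s i.

Definition orthonormal S q :=
  (forall s, (s < S)%N -> L (q s)) /\
  (forall s t, (s < S)%N -> (t < S)%N -> l2ip (q s) (q t) = (s == t)%:R).

Lemma combS S c q :
  comb S.+1 c q = (fun i => c S * q S i + comb S c q i).
Proof. by apply: funext => i; rewrite /comb big_ord_recr /= addrC. Qed.

Lemma comb_in S c q : (forall s, (s < S)%N -> L (q s)) -> L (comb S c q).
Proof.
elim: S => [|S IH] Lq; last first.
  by rewrite combS; apply: Llin; [apply: Lq | apply: IH => s sS; apply: Lq; lia].
by rewrite (_ : comb _ _ _ = fun=> 0) //; apply: funext => i; rewrite /comb big_ord0.
Qed.

Lemma l2ip_comb S c q w : (forall s, (s < S)%N -> L (q s)) -> L w ->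
  l2ip (comb S c q) w = \sum_(s < S) c s * l2ip (q s) w.
Proof.
elim: S => [|S IH] Lq Lw.
  rewrite big_ord0 (_ : comb _ _ _ = fun=> 0) ?l2ip0l //.
  by apply: funext => i; rewrite /comb big_ord0.
have LqS s : (s < S)%N -> L (q s) by move=> sS; apply: Lq; lia.
rewrite combS l2ip_linear ?IH ?big_ord_recr /= 1?addrC //; first exact: Lq.
exact: comb_in.
Qed.

Lemma l2ip_comb_orthonormal S c q t : orthonormal S q -> (t < S)%N ->
  l2ip (comb S c q) (q t) = c t.
Proof.
move=> [Lq oq] tS; rewrite l2ip_comb //; last exact: Lq.
rewrite (bigD1 (Ordinal tS)) //= oq // eqxx mulr1 big1 ?addr0 // => s st.
by rewrite oq // (_ : (s == t :> nat) = false) ?mulr0 //; apply: negbTE.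
Qed.

Lemma l2sqr_comb S c q : orthonormal S q ->
  l2sqr (comb S c q) = \sum_(s < S) normc (c s) ^+ 2.
Proof.
move=> oq; have Lc := comb_in c oq.1.
rewrite /l2sqr l2ip_comb //; last exact: oq.1.
rewrite Re_sum; apply: eq_bigr => s _.
rewrite l2ip_sym //; last exact: oq.1.
by rewrite l2ip_comb_orthonormal // normc_sqr.
Qed.

(** The combination with coefficients [conj (q_s(i))] has the same number [B] as its coordinate [i]
    and as its squared norm, so [B^2 <= B]. The bound is independent of [S], which makes the maximal
    energy in [near_complete_orthonormal] finite. *)
Lemma orthonormal_coord_le1 S q i : orthonormal S q ->
  \sum_(s < S) normc (q s i) ^+ 2 <= 1.
Proof.
move=> oq; pose c s := conjc (q s i).
have := l2sqr_ge_coord i (comb_in c oq.1); rewrite l2sqr_comb //.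
have -> : \sum_(s < S) normc (c s) ^+ 2 = \sum_(s < S) normc (q s i) ^+ 2.
  by apply: eq_bigr => s _; rewrite normc_conjc.
have -> : comb S c q i = (\sum_(s < S) normc (q s i) ^+ 2)%:C.
  by rewrite -sum_real_complex; apply: eq_bigr => s _; rewrite mulrC mulc_conjc.
have B0 : 0 <= \sum_(s < S) normc (q s i) ^+ 2.
  by apply: sumr_ge0 => s _; apply: sqr_ge0.
rewrite normc_real ger0_norm // => h.
by apply: le_of_sqr_le_mul; rewrite ?mul1r.
Qed.

Lemma residual_orthogonal S q u : orthonormal S q -> L u ->
  let r := fun i => -1 * comb S (fun s => l2ip u (q s)) q i + u i in
  [/\ L r, forall s, (s < S)%N -> l2ip r (q s) = 0 & l2sqr r <= l2sqr u].
Proof.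
move=> oq Lu r; pose c s := l2ip u (q s).
have Lc := comb_in c oq.1; have Lr : L r by apply: Llin.
have rq s : (s < S)%N -> l2ip r (q s) = 0.
  move=> sS; rewrite l2ip_linear //; last exact: oq.1.
  by rewrite l2ip_comb_orthonormal // mulN1r addNr.
split=> //.
have rc : l2ip (comb S c q) r = 0.
  rewrite l2ip_comb //; last exact: oq.1.
  rewrite big1 // => s _; rewrite l2ip_sym ?rq ?conjc0 ?mulr0 //.
  exact: oq.1.
have -> : l2sqr u = l2sqr r + l2sqr (comb S c q).
  have -> : u = (fun i => 1 * r i + comb S c q i).
    by apply: funext => i; rewrite /r -/c; ring.
  set U := (fun i => 1 * r i + _); have LU : L U by apply: Llin.
  have cr : l2ip r (comb S c q) = 0 by rewrite l2ip_sym // rc conjc0.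
  have Ur : l2ip U r = l2ip r r by rewrite l2ip_linear // rc mul1r addr0.
  have Uc : l2ip U (comb S c q) = l2ip (comb S c q) (comb S c q).
    by rewrite l2ip_linear // cr mulr0 add0r.
  rewrite {1}/l2sqr {1}/U l2ip_linear // mul1r ReD (l2ip_sym Lr LU) Ur.
  by rewrite (l2ip_sym Lc LU) Uc !Re_conjc.
by rewrite lerDl l2sqr_ge0.
Qed.

(* A family almost maximising the energy carried by the first [N] coordinates
   captures those coordinates of every element of [L]: a large residual could
   be normalised and added to the family. *)
Lemma near_complete_orthonormal N (d : R) : 0 < d ->
  exists S q, orthonormal S q /\ forall u i, L u -> (i < N)%N ->
    normc (u i - comb S (fun s => l2ip u (q s)) q i) ^+ 2 <= d * l2sqr u.
Proof.
move=> d0.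
pose en S q : R := \sum_(i < N) \sum_(s < S) normc (q s i) ^+ 2.
pose E := [set e | exists S q, orthonormal S q /\ e = en S q].
have supE : has_sup E.
  split; first by exists (en 0%N (fun _ _ => 0)), 0%N, (fun _ _ => 0).
  exists (\sum_(i < N) 1) => _ [S [q [oq ->]]].
  by apply: ler_sum => i _; apply: orthonormal_coord_le1.
have [_ [S [q [oq ->]]] enq] := sup_adherent d0 supE.
exists S, q; split=> // u i Lu iN.
have [Lr rq ru] := residual_orthogonal oq Lu; set r := (fun i => _) in Lr rq ru.
have -> : u i - comb S (fun s => l2ip u (q s)) q i = r i by rewrite /r; ring.
apply: le_trans (ler_wpM2l (ltW d0) ru).
have [r0|rn] := eqVneq (l2sqr r) 0.
  by rewrite r0 mulr0 -r0; apply: l2sqr_ge_coord.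
have rp : 0 < l2sqr r by rewrite lt_neqAle eq_sym rn l2sqr_ge0.
(* Appending the normalised residual raises the energy by [k^2] times the sum of [|r_j|^2] over
   [j < N]; near-maximality forces this gain to be at most [d]. *)
pose k : R := (Num.sqrt (l2sqr r))^-1.
have k2 : k ^+ 2 * l2sqr r = 1 by rewrite exprVn sqr_sqrtr 1?ltW // mulVf.
pose r1 j := k%:C * r j + 0.
have Lr1 : L r1 by apply: Llin.
pose q' s := if (s < S)%N then q s else r1.
have r1q s : (s < S)%N -> l2ip r1 (q s) = 0.
  move=> sS; rewrite l2ip_linear //; last exact: oq.1.
  by rewrite rq // l2ip0l ?mulr0 ?addr0 //; apply: oq.1.
have oq' : orthonormal S.+1 q'.
  split=> [s sS|s t sS tS]; first by rewrite /q'; case: ifP => // /oq.1.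
  rewrite /q'; case: ltnP => s1; case: ltnP => t1.
  - exact: oq.2.
  - rewrite l2ip_sym //; last exact: oq.1.
    by rewrite r1q // conjc0 (_ : (s == t) = false) //; apply/eqP; lia.
  - by rewrite r1q // (_ : (s == t) = false) //; apply/eqP; lia.
  have -> : s = t by lia.
  rewrite eqxx l2ip_linear // l2ip0l // addr0 l2ip_sym // l2ip_linear // l2ip0l //.
  rewrite addr0 l2ip_self // -rmorphM conjc_real -rmorphM /=.
  by rewrite mulrA -expr2 k2.
have : en S.+1 q' <= sup E by apply: ub_le_sup; [case: supE | exists S.+1, q'].
have -> : en S.+1 q' = en S q + k ^+ 2 * \sum_(j < N) normc (r j) ^+ 2.
  rewrite /en mulr_sumr -big_split; apply: eq_bigr => j _ /=.
  rewrite big_ord_recr /= /q' ltnn; congr (_ + _).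
    by apply: eq_bigr => s _; rewrite ltn_ord.
  by rewrite /r1 addr0 normcM normc_real exprMn real_normK ?num_real.
move=> h; have {h} : k ^+ 2 * \sum_(j < N) normc (r j) ^+ 2 <= d.
  by move: h enq; set X := _ * _; lra.
have : normc (r i) ^+ 2 <= \sum_(j < N) normc (r j) ^+ 2.
  rewrite (bigD1 (Ordinal iN)) //= lerDl sumr_ge0 // => j _.
  exact: sqr_ge0.
move=> h1 h2; rewrite -[leLHS]mul1r -k2 mulrAC ler_pM2r //.
by apply: le_trans h2; rewrite ler_wpM2l ?sqr_ge0.
Qed.

(** Cauchy-Schwarz beyond [K], keeping only the tail of [v]. For [v] in a finite family one [K] then
    serves all [u] of bounded norm. *)
Lemma l2ip_tail u v K : L u -> L v ->
  normc (l2ip u v - partial_ip u v K) ^+ 2 <=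
  l2sqr u * (l2sqr v - \sum_(0 <= i < K) normc (v i) ^+ 2).
Proof.
move=> Lu Lv; set C := _ * _.
have C0 : 0 <= C by rewrite mulr_ge0 ?l2sqr_ge0 // subr_ge0 l2sqr_ge_partial.
rewrite -(sqr_sqrtr C0) ler_pXn2r ?nnegrE ?normc_ge0 ?sqrtr_ge0 //.
apply: (ccvg_normc_le (N := K) (l2ip_cvg Lu Lv)) => K' KK'.
rewrite -(ger0_norm (normc_ge0 _)) -sqrtr_sqr ler_wsqrtr //.
rewrite /partial_ip (big_cat_nat (leq0n K) KK') /= addrAC subrr add0r.
apply: (@le_trans _ _ ((\sum_(K <= i < K') normc (u i) * normc (v i)) ^+ 2)).
  rewrite ler_pXn2r ?nnegrE ?normc_ge0 ?sumr_ge0 //; last first.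
    by move=> i _; rewrite mulr_ge0 ?normc_ge0.
  apply: le_trans (normc_sum _ _ _) _; apply: ler_sum => i _.
  by rewrite normcM normc_conjc.
apply: le_trans (sum_CauchySchwarz _ _ _ _) _.
have sq0 w i : 0 <= normc (w i) ^+ 2 by apply: sqr_ge0.
apply: ler_pM; rewrite ?sumr_ge0 //.
  apply: le_trans (l2sqr_ge_partial K' Lu).
  by rewrite (big_cat_nat (leq0n K) KK') /= lerDr sumr_ge0.
rewrite lerBrDl; apply: le_trans (l2sqr_ge_partial K' Lv).
by rewrite (big_cat_nat (leq0n K) KK').
Qed.

Lemma partial_sqr_cvg u (e : R) : L u -> 0 < e ->
  exists N, forall K, (N <= K)%N -> l2sqr u - \sum_(0 <= i < K) normc (u i) ^+ 2 <= e.
Proof.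
move=> Lu e0; have [N NP] := l2ip_cvg Lu Lu e0; exists N => K /NP.
rewrite partial_ip_self l2ip_self // -rmorphB normc_real distrC.
exact: le_trans (ler_norm _).
Qed.

(** Projection coefficients are cut to finite sums so that finite combinations of operators can
    realise them. [K0] precedes [u] because [u] will range over the sequences [<a_i y, eta>] for all
    [y] and [eta]. *)
Lemma truncated_projection N (d : R) : 0 < d ->
  exists S q K0, orthonormal S q /\
    forall K u i, (K0 <= K)%N -> L u -> (i < N)%N ->
    normc (u i - comb S (fun s => partial_ip u (q s) K) q i) <=
      d * Num.sqrt (l2sqr u).
Proof.
move=> d0; have d2 : 0 < d / 2 by rewrite divr_gt0.
have [S [q [oq qP]]] := near_complete_orthonormal N (exprn_gt0 2 d2).
have tails (e : R) : 0 < e -> exists K0, forall K s, (K0 <= K)%N -> (s < S)%N ->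
    l2sqr (q s) - \sum_(0 <= i < K) normc (q s i) ^+ 2 <= e.
  move=> e0; have [Lq _] := oq; elim: S Lq {oq qP} => [|S IH] Lq.
    by exists 0%N.
  have [|K1 K1P] := IH; first by move=> s sS; apply: Lq; lia.
  have [K2 K2P] := partial_sqr_cvg (Lq S (ltnSn S)) e0.
  exists (maxn K1 K2) => K s; rewrite geq_max => /andP[k1 k2].
  rewrite ltnS leq_eqVlt => /orP[/eqP-> |sS]; [exact: K2P | exact: K1P].
(* Half of [d] is shared among the [S] truncated coefficients; [S.+1] allows for an empty family. *)
pose t := d / 2 / S.+1%:R; have t0 : 0 < t by rewrite divr_gt0.
have [K0 K0P] := tails _ (exprn_gt0 2 t0).
exists S, q, K0; split=> // K u i K0K Lu iN.
have u0 := sqrtr_ge0 (l2sqr u).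
have -> : u i - comb S (fun s => partial_ip u (q s) K) q i =
    (u i - comb S (fun s => l2ip u (q s)) q i) +
    \sum_(s < S) (l2ip u (q s) - partial_ip u (q s) K) * q s i.
  have -> : \sum_(s < S) (l2ip u (q s) - partial_ip u (q s) K) * q s i =
      comb S (fun s => l2ip u (q s)) q i - comb S (fun s => partial_ip u (q s) K) q i.
    by rewrite -sumrB; apply: eq_bigr => s _; rewrite mulrBl.
  by ring.
apply: le_trans (le_normcD _ _) _; rewrite [d in leRHS]splitr mulrDl; apply: lerD.
  rewrite -(@ler_pXn2r _ 2) ?nnegrE ?normc_ge0 ?(mulr_ge0 (ltW d2)) //.
  by rewrite exprMn sqr_sqrtr ?l2sqr_ge0 //; apply: qP.
apply: le_trans (normc_sum _ _ _) _.
apply: (@le_trans _ _ (\sum_(s < S) t * Num.sqrt (l2sqr u))).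
  apply: ler_sum => s _; rewrite normcM.
  have q1 : normc (q s i) <= 1.
    rewrite -(@ler_pXn2r _ 2) ?nnegrE ?normc_ge0 // expr1n.
    apply: le_trans (orthonormal_coord_le1 i oq).
    by rewrite (bigD1 s) //= lerDl sumr_ge0 // => j _; apply: sqr_ge0.
  apply: le_trans (ler_piMr (normc_ge0 _) q1) _.
  rewrite -(@ler_pXn2r _ 2) ?nnegrE ?normc_ge0 ?(mulr_ge0 (ltW t0)) //.
  apply: le_trans (l2ip_tail K Lu (oq.1 s (ltn_ord s))) _.
  rewrite exprMn sqr_sqrtr ?l2sqr_ge0 // mulrC ler_wpM2r ?l2sqr_ge0 //.
  exact: K0P.
rewrite sumr_const card_ord -[leLHS]mulr_natl mulrA ler_wpM2r //.
rewrite /t mulrCA ler_piMr ?(ltW d2) // ler_pdivrMr // mul1r ler_nat.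
exact: leqnSn.
Qed.

End Orthonormal.

(** * Finitely many separating functionals *)

Section OrthonormalVectors.
Variables (R : realType) (H : lmodType R[i]) (ip : H -> H -> R[i]).
Hypothesis ipP : is_inner_product ip.
Variable L : set (nat -> R[i]).
Hypothesis Lsq : forall u, L u -> square_summable u.
Variables (S : nat) (q : nat -> nat -> R[i]).
Hypothesis oq : orthonormal L S q.
Local Notation "`‖ x ‖" := (hnorm ip x).

(** The matrix [conj (q_s(j))] maps [H^S] isometrically into [l^2(H)]: expanded through the
    truncated Gram matrix of the family, the partial sums increase to the right-hand side. *)
Lemma orthonormal_synthesis (z : nat -> H) K :
  \sum_(0 <= j < K) `‖\sum_(s < S) conjc (q s j) *: z s‖ ^+ 2 <=
  \sum_(s < S) `‖z s‖ ^+ 2.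
Proof.
pose f K := \sum_(0 <= j < K) `‖\sum_(s < S) conjc (q s j) *: z s‖ ^+ 2.
have fE K' : (f K')%:C =
    \sum_(s < S) \sum_(t < S) ip (z s) (z t) * partial_ip (q t) (q s) K'.
  rewrite -sum_real_complex; under eq_bigr do rewrite -(ip_self ipP).
  under [RHS]eq_bigr do under eq_bigr do rewrite /partial_ip mulr_sumr.
  under [RHS]eq_bigr do rewrite exchange_big /=.
  rewrite [RHS]exchange_big /=; apply: eq_bigr => j _.
  rewrite (ip_sumZl ipP); apply: eq_bigr => s _.
  rewrite (ip_sumr ipP) mulr_sumr; apply: eq_bigr => t _.
  by rewrite (ipZr ipP) conjcK; ring.
have -> : \sum_(s < S) `‖z s‖ ^+ 2 =
    complex.Re (\sum_(s < S) \sum_(t < S) ip (z s) (z t) * l2ip (q t) (q s)).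
  rewrite Re_sum; apply: eq_bigr => s _.
  rewrite (bigD1 s) //= oq.2 // eqxx mulr1 big1 ?addr0 -?hnorm_sqr // => t ts.
  by rewrite oq.2 // (negbTE (_ : t != s :> nat)) // mulr0.
apply: (@ccvg_nondecreasing_le R f).
  by apply: sum_nat_nondecreasing => i; apply: sqr_ge0.
apply: ccvg_eq (fun K => esym (fE K)) _.
have cvg_fam (s t : 'I_S) : ccvg (fun K => ip (z s) (z t) * partial_ip (q t) (q s) K)
    (ip (z s) (z t) * l2ip (q t) (q s)).
  by apply: ccvgZ; apply: l2ip_ccvg; apply: Lsq; apply: oq.1.
by apply: ccvg_sum => s; apply: ccvg_sum => t; apply: cvg_fam.
Qed.

(** The adjoint of that isometry is a contraction: the left-hand side [X] is the pairing of [h] with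
    the synthesis of [z], whence [X^2 <= Y X]. *)
Lemma orthonormal_bessel (h : nat -> H) m K : (m <= K)%N ->
  \sum_(s < S) `‖\sum_(m <= i < K) q s i *: h i‖ ^+ 2 <=
  \sum_(m <= i < K) `‖h i‖ ^+ 2.
Proof.
move=> mK; pose z s := \sum_(m <= i < K) q s i *: h i.
rewrite -/(z _); set X := \sum_(s < S) _; set Y := \sum_(m <= i < K) _.
have X0 : 0 <= X by apply: sumr_ge0 => s _; apply: sqr_ge0.
have Y0 : 0 <= Y by apply: sumr_ge0 => s _; apply: sqr_ge0.
have XE : X%:C = \sum_(m <= i < K) ip (h i) (\sum_(s < S) conjc (q s i) *: z s).
  rewrite /X -sum_real_complex; under eq_bigr do rewrite -(ip_self ipP).
  under [RHS]eq_bigr do rewrite (ip_sumr ipP).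
  rewrite exchange_big; apply: eq_bigr => s _ /=.
  rewrite {1}/z (ip_sumZl ipP); apply: eq_bigr => i _.
  by rewrite (ipZr ipP) conjcK.
apply: le_of_sqr_le_mul => //.
have -> : X ^+ 2 = normc X%:C ^+ 2 by rewrite normc_real ger0_norm.
rewrite XE; apply: le_trans (normc_sum_ip ipP _ _ _ _) _; rewrite -/Y.
rewrite ler_wpM2l //; apply: le_trans (orthonormal_synthesis z K).
rewrite (big_cat_nat (leq0n m) mK) /= lerDr.
by apply: sumr_ge0 => i _; apply: sqr_ge0.
Qed.

End OrthonormalVectors.

(** * Row operators, uniform commutation of slices, approximate factorisation of the identity *)

Section MainEstimate.
Variables (R : realType) (H : lmodType R[i]) (ip : H -> H -> R[i]).
Hypothesis hilbP : is_hilbert ip.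
Let ipP : is_inner_product ip := proj1 hilbP.
Variable A : set (op H).
Hypothesis AP : unital_subalgebra ip A.
Variables (a b : nat -> op H) (alpha : R).
Hypothesis ds : diagonal_series ip A a b alpha.
Local Notation "`‖ x ‖" := (hnorm ip x).

Let a_bounded i : is_bounded_op ip (a i).
Proof. exact: alg_bounded AP _ (ds_inl ds i). Qed.

Let a_linear i : is_linear_op (a i).
Proof. by case: (a_bounded i). Qed.

Let alpha0 : 0 <= alpha := ds_ge0 ds.

Let sq0 (x : H) : 0 <= `‖x‖ ^+ 2.
Proof. exact: sqr_ge0. Qed.

Lemma sum_tail_le (f : nat -> R) m K : (forall i, 0 <= f i) ->
  \sum_(m <= i < K) f i <= \sum_(0 <= i < K) f i.
Proof.
move=> f0; have [mK|/ltnW Km] := leqP m K.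
  by rewrite (big_cat_nat (leq0n m) mK) /= lerDr sumr_ge0.
by rewrite big_geq // sumr_ge0.
Qed.

Lemma row_op_bound (y : nat -> H) m K :
  `‖\sum_(m <= i < K) a i (y i)‖ ^+ 2 <= alpha * \sum_(m <= i < K) `‖y i‖ ^+ 2.
Proof.
set z := \sum_(m <= i < K) _; set Y := \sum_(m <= i < K) _.
have Y0 : 0 <= Y by apply: sumr_ge0.
apply: le_of_sqr_le_mul; [exact: sq0 | exact: mulr_ge0 |].
have -> : (`‖z‖ ^+ 2) ^+ 2 = normc (ip z z) ^+ 2.
  by rewrite (ip_self ipP) normc_real ger0_norm.
rewrite {1}/z (ip_suml ipP); under eq_bigr do rewrite (adjP hilbP) //.
apply: le_trans (normc_sum_ip ipP _ _ _ _) _; rewrite -/Y mulrAC mulrC.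
rewrite ler_wpM2r //; apply: le_trans (ds_row ds K z).
exact: sum_tail_le.
Qed.

Lemma coef_sqr_bound xi eta m K :
  \sum_(m <= i < K) normc (ip (a i xi) eta) ^+ 2 <= alpha * (`‖xi‖ * `‖eta‖) ^+ 2.
Proof.
apply: (@le_trans _ _ (`‖xi‖ ^+ 2 * \sum_(0 <= i < K) `‖adj ip (a i) eta‖ ^+ 2)).
  apply: le_trans (sum_tail_le _ _ _) _; first by move=> i; apply: sqr_ge0.
  rewrite mulr_sumr; apply: ler_sum => i _; rewrite (adjP hilbP) // -exprMn.
  rewrite ler_pXn2r ?nnegrE ?mulr_ge0 ?normc_ge0 ?hnorm_ge0 //.
  exact: CauchySchwarz.
by rewrite exprMn mulrCA ler_wpM2l // (ds_row ds).
Qed.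

(** This is [L]. A member comes with a finite list of vector pairs, hence with finitely many
    functionals; scalars are absorbed into the first vectors. *)
Definition coef_space : set (nat -> R[i]) := [set u |
  exists l : seq (H * H), forall i, u i = \sum_(p <- l) ip (a i p.1) p.2].

Lemma coef_space0 : coef_space (fun=> 0).
Proof. by exists [::] => i; rewrite big_nil. Qed.

Lemma coef_space_lin k u v : coef_space u -> coef_space v ->
  coef_space (fun i => k * u i + v i).
Proof.
move=> [l ul] [l' vl]; exists ([seq (k *: p.1, p.2) | p <- l] ++ l') => i.
rewrite big_cat big_map /= ul vl mulr_sumr; congr (_ + _).
by apply: eq_bigr => p _; rewrite linear_opZ // (ipZl ipP).
Qed.

Lemma coef_space_coef xi eta : coef_space (fun i => ip (a i xi) eta).
Proof. by exists [:: (xi, eta)] => i; rewrite big_seq1. Qed.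

Lemma coef_space_summable u : coef_space u -> square_summable u.
Proof.
move=> [l]; elim: l u => [|[xi eta] l IH] u ul.
  exists 0 => K; rewrite big1 // => i _.
  by rewrite ul big_nil normc0 expr0n.
have -> : u = (fun i => 1 * ip (a i xi) eta + \sum_(p <- l) ip (a i p.1) p.2).
  by apply: funext => i; rewrite ul big_cons mul1r.
apply: square_summable_lin; last exact: IH.
by exists (alpha * (`‖xi‖ * `‖eta‖) ^+ 2) => K; apply: coef_sqr_bound.
Qed.

(** Uniform form of [ds_comm]. Between [K] and the truncation that [ds_comm] supplies lie only
    pieces with a small column, and their size is proportional to [‖c‖ ‖x‖]. *)
Lemma slice_commutes xi eta (k : R) : 0 < k -> exists K0, forall K c x,
  (K0 <= K)%N -> A c ->
  `‖\sum_(0 <= i < K) ip (a i xi) eta *: b i (c x) -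
    \sum_(0 <= i < K) ip (c (a i xi)) eta *: b i x‖ <= k * (opnorm ip c * `‖x‖).
Proof.
move=> k0; pose r := Num.sqrt alpha; pose g := r * (`‖xi‖ * `‖eta‖).
have g0 : 0 <= g by rewrite !mulr_ge0 ?sqrtr_ge0 ?hnorm_ge0.
(* Two tails, each at most [g * e] times [‖c‖ ‖x‖], have to fit into [k]. *)
pose e := k / (2 * (g + 1)).
have e0 : 0 < e by rewrite divr_gt0 // mulr_gt0 // ltr_wpDl.
have ge : 2 * (g * e) <= k.
  rewrite (_ : 2 * (g * e) = k * (g / (g + 1))); last first.
    by rewrite /e; field; rewrite gt_eqF // ltr_wpDl.
  by rewrite ler_piMr ?(ltW k0) // ler_pdivrMr ?ltr_wpDl // mul1r lerDl.
clearbody e.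
have [N NP] := ds_col ds (exprn_gt0 2 e0); exists N => K c x NK Ac.
have bc := alg_bounded AP Ac; have M0 := opnorm_ge0 hilbP bc.
set M := opnorm ip c in M0 *.
have Mx0 : 0 <= M * `‖x‖ by rewrite mulr_ge0 ?hnorm_ge0.
have tail K' y : \sum_(K <= i < K') `‖b i y‖ ^+ 2 <= e ^+ 2 * `‖y‖ ^+ 2.
  apply: le_trans (NP K' y); have [KK'|/ltnW K'K] := leqP K K'.
    by rewrite (big_cat_nat NK KK') /= lerDr sumr_ge0.
  by rewrite big_geq // sumr_ge0.
have slice_tail K' (u : nat -> R[i]) y (m n : R) : 0 <= m -> `‖y‖ <= n ->
    \sum_(K <= i < K') normc (u i) ^+ 2 <= alpha * m ^+ 2 ->
    `‖\sum_(K <= i < K') u i *: b i y‖ <= r * m * (e * n).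
  move=> m0 yn um; have n0 := le_trans (hnorm_ge0 ip y) yn.
  rewrite -(@ler_pXn2r _ 2) ?nnegrE ?hnorm_ge0 ?mulr_ge0 ?sqrtr_ge0 ?(ltW e0) //.
  apply: le_trans (hnorm_sum_scale ipP _ _ _ _) _.
  rewrite exprMn; apply: ler_pM.
  - by apply: sumr_ge0 => i _; apply: sqr_ge0.
  - by apply: sumr_ge0.
  - by rewrite exprMn sqr_sqrtr.
  apply: le_trans (tail K' y) _; rewrite [leRHS]exprMn ler_wpM2l ?sqr_ge0 //.
  by rewrite ler_pXn2r ?nnegrE ?hnorm_ge0.
(* [K'] will depend on [c], [x] and [e'], but the tail bounds do not depend on [K']. *)
apply/ler_addgt0Pr => e' e'0.
have [K' KK' K'P] := ds_comm ds xi eta x K Ac e'0.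
move: K'P; rewrite !(big_cat_nat (leq0n K) KK') /=.
set t1 := \sum_(K <= i < K') ip (a i xi) eta *: _.
set t2 := \sum_(K <= i < K') ip (c _) eta *: _.
set s1 := \sum_(0 <= i < K) _; set s2 := \sum_(0 <= i < K) _ => D'.
have -> : s1 - s2 = (s1 + t1 - (s2 + t2)) + (t2 - t1).
  by rewrite opprD [s1 + t1 + _]addrACA -(opprB t1 t2) addrK.
apply: le_trans (hnormD ipP _ _) _; rewrite addrC; apply: lerD => //.
apply: le_trans (hnormD ipP _ _) _; rewrite (hnormN ipP).
have h1 : `‖t1‖ <= g * (e * (M * `‖x‖)).
  rewrite /g; apply: slice_tail; rewrite ?mulr_ge0 ?hnorm_ge0 //.
    exact: opnorm_bound.
  exact: coef_sqr_bound.
(* [<c a_i xi, eta> = <a_i xi, c^* eta>]: moving [c] onto [eta] leaves a coefficient sequence of [a]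
   and costs the factor [M]. *)
have h2 : `‖t2‖ <= r * (M * (`‖xi‖ * `‖eta‖)) * (e * `‖x‖).
  apply: slice_tail; rewrite ?mulr_ge0 ?hnorm_ge0 //.
  under eq_bigr do rewrite (adjP hilbP bc).
  apply: le_trans (coef_sqr_bound _ _ _ _) _; rewrite ler_wpM2l //.
  rewrite ler_pXn2r ?nnegrE ?mulr_ge0 ?hnorm_ge0 // mulrCA.
  rewrite ler_wpM2l ?hnorm_ge0 //; apply: (adj_bound hilbP) => //.
  exact: opnorm_bound.
apply: le_trans (lerD h2 h1) _.
rewrite (_ : _ + _ = 2 * (g * e) * (M * `‖x‖)); last by rewrite /g; ring.
exact: ler_wpM2r.
Qed.

Lemma slices_commute (l : seq (H * H)) (k : R) : 0 < k ->
  exists K0, forall K c x p, (K0 <= K)%N -> A c -> p \in l ->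
  `‖\sum_(0 <= i < K) ip (a i p.1) p.2 *: b i (c x) -
    \sum_(0 <= i < K) ip (c (a i p.1)) p.2 *: b i x‖ <= k * (opnorm ip c * `‖x‖).
Proof.
move=> k0; elim: l => [|[xi eta] l [K1 K1P]]; first by exists 0%N.
have [K2 K2P] := slice_commutes xi eta k0; exists (maxn K1 K2) => K c x p.
rewrite geq_max inE => /andP[k1 k2] Ac /orP[/eqP-> /=|pl].
  exact: K2P.
exact: K1P.
Qed.

Definition synth (q : nat -> nat -> R[i]) K s : op H :=
  fun x => \sum_(0 <= j < K) conjc (q s j) *: a j x.

Lemma synth_linear q K s : is_linear_op (synth q K s).
Proof.
move=> k x y; rewrite /synth scaler_sumr -big_split; apply: eq_bigr => j _ /=.
by rewrite a_linear scalerDr !scalerA mulrC.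
Qed.

(** Interchanging the sums shows the row acting on the synthesis of [y]; hence the bound does not
    grow with [S]. *)
Lemma synth_sum_bound S q K (y : nat -> H) : orthonormal coef_space S q ->
  `‖\sum_(s < S) synth q K s (y s)‖ ^+ 2 <= alpha * \sum_(s < S) `‖y s‖ ^+ 2.
Proof.
move=> oq.
have -> : \sum_(s < S) synth q K s (y s) =
    \sum_(0 <= j < K) a j (\sum_(s < S) conjc (q s j) *: y s).
  rewrite exchange_big; apply: eq_bigr => j _ /=.
  by rewrite linear_op_sum //; apply: eq_bigr => s _; rewrite linear_opZ.
apply: le_trans (row_op_bound _ _ _) _; rewrite ler_wpM2l //.
by apply: (orthonormal_synthesis ipP coef_space_summable).
Qed.

(** Tested against [eta], this is [truncated_projection] for the sequence [<a_i y, eta>], of norm at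
    most [sqrt alpha ‖y‖ ‖eta‖]. It is the quantitative form of the row vanishing on the orthogonal
    complement of [L]. *)
Lemma synth_approx N (d : R) : 0 < d ->
  exists S q K0, orthonormal coef_space S q /\
    forall K i y, (K0 <= K)%N -> (i < N)%N ->
    `‖a i y - \sum_(s < S) q s i *: synth q K s y‖ <=
      d * Num.sqrt alpha * `‖y‖.
Proof.
move=> d0; have [S [q [K0 [oq qP]]]] :=
  truncated_projection coef_space0 coef_space_lin coef_space_summable N d0.
exists S, q, K0; split=> // K i y K0K iN.
apply: (hnorm_le_ip ipP); first by rewrite !mulr_ge0 ?sqrtr_ge0 ?hnorm_ge0 ?(ltW d0).
move=> eta; have Lu := coef_space_coef y eta.
have -> : ip (a i y - \sum_(s < S) q s i *: synth q K s y) eta = ip (a i y) eta -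
    comb S (fun s => partial_ip (fun i => ip (a i y) eta) (q s) K) q i.
  rewrite (ipBl ipP) (ip_sumZl ipP); congr (_ - _); apply: eq_bigr => s _.
  rewrite mulrC (ip_sumZl ipP); congr (_ * _); apply: eq_bigr => j _.
  by rewrite mulrC.
apply: le_trans (qP K _ i K0K Lu iN) _; rewrite -!mulrA ler_wpM2l ?(ltW d0) //.
have yeta : 0 <= `‖y‖ * `‖eta‖ by rewrite mulr_ge0 ?hnorm_ge0.
rewrite -(ger0_norm yeta) -sqrtr_sqr -sqrtrM // ler_wsqrtr //.
by apply: (l2sqr_le coef_space_summable Lu) => K'; apply: coef_sqr_bound.
Qed.

Lemma sum_b_bound N : exists2 B, 0 <= B &
  forall y, \sum_(0 <= i < N) `‖b i y‖ <= B * `‖y‖.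
Proof.
elim: N => [|N [B B0 BP]]; first by exists 0 => // y; rewrite big_geq ?mul0r.
have [M M0 MP] := bounded_op_bound (alg_bounded AP (ds_inr ds N)).
exists (B + M); first exact: addr_ge0.
by move=> y; rewrite big_nat_recr //= mulrDl lerD.
Qed.

Lemma coef_space_lists S q : orthonormal coef_space S q ->
  exists ls : nat -> seq (H * H), forall s i, (s < S)%N ->
    q s i = \sum_(p <- ls s) ip (a i p.1) p.2.
Proof.
move=> [Lq _].
have /choice[ls lsP] s : exists l : seq (H * H), (s < S)%N ->
    forall i, q s i = \sum_(p <- l) ip (a i p.1) p.2.
  case: (ltnP s S) => [/Lq[l lP]|_]; first by exists l.
  by exists [::].
by exists ls => s i /lsP.
Qed.

(* [1] is within distance [1/2] of [sum_s synth_s * (sum_(i < K) q_s(i) b_i)], and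
   right multiplication by such a [c] nearly annihilates the second factors. *)
Lemma finitely_many_coefs_separate : exists K (l : seq (H * H)),
  forall c, A c ->
  (forall i p, (i < K)%N -> p \in l -> ip (c (a i p.1)) p.2 = 0) ->
  forall x, c x = 0.
Proof.
pose r := Num.sqrt alpha; have r0 : 0 <= r := sqrtr_ge0 _.
have r2 : r ^+ 2 = alpha by rewrite sqr_sqrtr.
(* The final estimate has five error terms: four will be at most [‖c x‖ / 8], one at most
   [‖c‖ ‖x‖ / 8]. *)
have [e e0 [e8 re8]] : exists2 e : R, 0 < e & e <= 8^-1 /\ r * e <= 8^-1.
  have r1 : 0 < r + 1 by rewrite ltr_wpDl.
  exists (8^-1 / (r + 1)); first by rewrite divr_gt0 ?invr_gt0.
  rewrite mulrA !ler_pdivrMr //; split; move: r0; lra.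
have [N NP] := ds_col ds (exprn_gt0 2 e0).
have [B B0 BP] := sum_b_bound N.
have [d d0 d8] : exists2 d : R, 0 < d & d * r * B <= 8^-1.
  have rB : 0 < r * B + 1 by rewrite ltr_wpDl // mulr_ge0.
  exists (8^-1 / (r * B + 1)); first by rewrite divr_gt0 ?invr_gt0.
  rewrite -mulrA mulrAC ler_pdivrMr //; lra.
have [S [q [K1 [oq qP]]]] := synth_approx N d0.
have [ls lsP] := coef_space_lists oq.
pose l := flatten [seq ls s | s <- iota 0 S].
have lsl s : (s < S)%N -> {subset ls s <= l}.
  move=> sS p ps; apply/flattenP; exists (ls s) => //.
  by apply: map_f; rewrite mem_iota.
pose n := \max_(s < S) size (ls s).
(* [k1 X] will bound each of the [S] vectors [v s]; the row then turns them into a vector of norm at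
   most [X / 8]. *)
have [k1 k10 k18] : exists2 k : R, 0 < k & alpha * (S%:R * k ^+ 2) <= 8^-1 ^+ 2.
  have rS : 0 < (r + 1) * (S%:R + 1) by rewrite mulr_gt0 // ltr_wpDl.
  exists (8^-1 / ((r + 1) * (S%:R + 1))); first by rewrite divr_gt0 ?invr_gt0.
  rewrite expr_div_n mulrA mulrCA ler_piMr ?sqr_ge0 //.
  rewrite ler_pdivrMr ?exprn_gt0 // mul1r -r2 exprMn.
  have S0 : 0 <= S%:R :> R by [].
  by apply: ler_pM; rewrite ?sqr_ge0 //; nra.
(* Each [q s] is a sum of at most [n] coefficient sequences, and each of these costs [k]. *)
have [k k0 nk] : exists2 k : R, 0 < k & n%:R * k <= k1.
  exists (k1 / (n%:R + 1)); first by rewrite divr_gt0 // ltr_wpDl.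
  have n0 : 0 < n%:R + 1 :> R by rewrite ltr_wpDl.
  rewrite mulrA ler_pdivrMr // mulrC ler_wpM2l ?(ltW k10) //.
  by rewrite lerDl.
have [K2 K2P] := slices_commute l k0.
(* A single [K] truncates the product, the projection coefficients and the slices. *)
have [K] := ds_mult ds (maxn N (maxn K1 K2)) e0.
rewrite !geq_max => /and3P[NK K1K K2K] KP.
exists K, l => c Ac cl.
have bc := alg_bounded AP Ac; set M := opnorm ip c.
have M0 : 0 <= M := opnorm_ge0 hilbP bc.
suff main x : `‖c x‖ <= M / 2 * `‖x‖.
  have M2 : M <= M / 2 by apply: opnorm_le => //; rewrite divr_ge0.
  have M_eq0 : M = 0 by lra.
  move=> x; apply: (hnorm_eq0 ipP); apply/eqP.
  rewrite eq_le hnorm_ge0 andbT (le_trans (opnorm_bound hilbP bc x)) //.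
  by rewrite -/M M_eq0 mul0r.
set y := c x; set Y := `‖y‖; set X := M * `‖x‖.
have Y0 : 0 <= Y := hnorm_ge0 ip y.
have X0 : 0 <= X by rewrite mulr_ge0 ?hnorm_ge0.
have YX : Y <= X := opnorm_bound hilbP bc x.
pose h i := b i y.
pose v s := \sum_(0 <= i < K) q s i *: h i.
pose w s := \sum_(N <= i < K) q s i *: h i.
have tailh : \sum_(N <= i < K) `‖h i‖ ^+ 2 <= (e * Y) ^+ 2.
  by rewrite exprMn; apply: NP.
have sq_le (t u z : R) : 0 <= u -> t ^+ 2 <= alpha * z -> alpha * z <= u ^+ 2 -> 0 <= t -> t <= u.
  move=> u0 h1 h2 t0; rewrite -(@ler_pXn2r _ 2) ?nnegrE //.
  exact: le_trans h1 h2.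
have reY : 0 <= r * (e * Y) by rewrite !mulr_ge0 ?(ltW e0).
have T1 : `‖\sum_(0 <= i < K) a i (h i) - y‖ <= e * Y by apply: KP.
have T2 : `‖\sum_(N <= i < K) a i (h i)‖ <= r * (e * Y).
  apply: (sq_le _ _ _ reY (row_op_bound _ _ _)); last exact: hnorm_ge0.
  by rewrite [leRHS]exprMn r2 ler_wpM2l.
have T3 : `‖\sum_(0 <= i < N) (a i (h i) - \sum_(s < S) q s i *: synth q K s (h i))‖
    <= d * r * B * Y.
  apply: le_trans (hnorm_sum ipP _ _ _) _.
  apply: (@le_trans _ _ (\sum_(0 <= i < N) d * r * `‖h i‖)).
    rewrite big_nat [leRHS]big_nat; apply: ler_sum => i /andP[_ iN].
    exact: qP.
  rewrite -mulr_sumr -[leRHS]mulrA ler_wpM2l ?mulr_ge0 ?(ltW d0) //.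
  exact: BP.
have T4 : `‖\sum_(s < S) synth q K s (w s)‖ <= r * (e * Y).
  apply: (sq_le _ _ _ reY (synth_sum_bound K w oq)); last exact: hnorm_ge0.
  rewrite [leRHS]exprMn r2 ler_wpM2l //; apply: le_trans tailh.
  exact: (orthonormal_bessel ipP coef_space_summable oq).
have vs (s : 'I_S) : `‖v s‖ <= k1 * X.
  (* The subtracted sums are zero by [cl]; they are inserted to match the commutation estimate. *)
  have -> : v s = \sum_(p <- ls s) (\sum_(0 <= i < K) ip (a i p.1) p.2 *: b i (c x) -
      \sum_(0 <= i < K) ip (c (a i p.1)) p.2 *: b i x).
    rewrite sumrB [X in _ - X]big1_seq ?subr0; last first.
      move=> p /andP[_ ps]; rewrite big_nat big1 // => i /andP[_ iK].
      by rewrite cl ?scale0r //; apply: lsl ps.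
    rewrite exchange_big; apply: eq_bigr => i _ /=.
    by rewrite lsP // scaler_suml.
  apply: le_trans (hnorm_sum ipP _ _ _) _.
  apply: (@le_trans _ _ (\sum_(p <- ls s) k * X)).
    rewrite big_seq [leRHS]big_seq; apply: ler_sum => p ps.
    by apply: K2P => //; apply: lsl ps.
  rewrite big_const_seq count_predT iter_addr_0 -mulr_natl mulrA ler_wpM2r //.
  apply: le_trans nk; rewrite ler_wpM2r ?(ltW k0) // ler_nat.
  exact: (leq_bigmax s).
have T5 : `‖\sum_(s < S) synth q K s (v s)‖ <= 8^-1 * X.
  apply: (sq_le _ _ _ _ (synth_sum_bound K v oq)); last exact: hnorm_ge0.
    by rewrite mulr_ge0 ?invr_ge0.
  apply: (@le_trans _ _ (alpha * \sum_(s < S) (k1 * X) ^+ 2)).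
    rewrite ler_wpM2l //; apply: ler_sum => s _.
    by rewrite ler_pXn2r ?nnegrE ?hnorm_ge0 ?vs // mulr_ge0 ?(ltW k10).
  rewrite sumr_const card_ord -[X in alpha * X]mulr_natl [leRHS]exprMn.
  rewrite (_ : alpha * _ = alpha * (S%:R * k1 ^+ 2) * X ^+ 2); last by ring.
  by rewrite ler_wpM2r ?sqr_ge0.
(* The projection replaces [a i] only for [i < N], whereas the slices [v s] run over all [i < K];
   subtracting [w s] corrects the difference. *)
have key : y = - (\sum_(0 <= i < K) a i (h i) - y) +
   (\sum_(N <= i < K) a i (h i) +
   (\sum_(0 <= i < N) (a i (h i) - \sum_(s < S) q s i *: synth q K s (h i)) +
   (\sum_(s < S) synth q K s (v s) - \sum_(s < S) synth q K s (w s)))).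
  have -> : \sum_(s < S) synth q K s (v s) - \sum_(s < S) synth q K s (w s) =
      \sum_(0 <= i < N) \sum_(s < S) q s i *: synth q K s (h i).
    rewrite [RHS]exchange_big -sumrB; apply: eq_bigr => s _ /=.
    rewrite /v (big_cat_nat (leq0n N) NK) /= -/(w s).
    rewrite (linear_opD _ _ (synth_linear q K s)) addrK.
    rewrite (linear_op_sum _ _ _ (synth_linear q K s)); apply: eq_bigr => i _.
    by rewrite (linear_opZ _ _ (synth_linear q K s)).
  rewrite sumrB subrK [\sum_(0 <= i < K) _](big_cat_nat (leq0n N) NK) /=.
  by rewrite opprB [X in _ + X]addrC subrK.
have : Y <= e * Y + (r * (e * Y) + (d * r * B * Y + (8^-1 * X + r * (e * Y)))).
  rewrite /Y {1}key.
  apply: le_trans (hnormD ipP _ _) _; rewrite hnormN //; apply: lerD => //.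
  apply: le_trans (hnormD ipP _ _) _; apply: lerD => //.
  apply: le_trans (hnormD ipP _ _) _; apply: lerD => //.
  by apply: le_trans (hnormD ipP _ _) _; rewrite hnormN //; apply: lerD.
(* The right-hand side is at most [Y / 2 + X / 8], so [Y <= X / 4]. *)
have := ler_wpM2r Y0 e8; have := ler_wpM2r Y0 re8; have := ler_wpM2r Y0 d8.
rewrite (mulrA r e Y) (_ : M / 2 * `‖x‖ = X / 2); last exact: mulrAC.
by move: (r * e * Y) (d * r * B * Y) (e * Y) => ? ? ?; lra.
Qed.

End MainEstimate.

(** Induction on the functionals: the kernel of the head has codimension at most one in [A]. Only
    closure under linear combinations is asked of [A], because the kernel need not be an algebra. *)
Lemma functionals_finite_dim (R : realType) (H : lmodType R[i]) (A : set (op H))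
    (fs : seq (op H -> R[i])) :
  (forall k S T, A S -> A T -> A (opadd (opscale k S) T)) ->
  (forall f k S T, f \in fs -> A S -> A T ->
     f (opadd (opscale k S) T) = k * f S + f T) ->
  (forall T, A T -> (forall f, f \in fs -> f T = 0) -> forall x, T x = 0) ->
  finite_dim A.
Proof.
elim: fs A => [|f fs IH] A Alin flin fsep.
  exists 0%N, (fun=> @opzero R H); split=> [[]//|T AT].
  by exists (fun=> 0) => x; rewrite big_ord0; apply: fsep.
have [[T0 [AT0 fT0]]|f0] := pselect (exists T, A T /\ f T != 0); last first.
  apply: (IH A) => // [g k S T gfs|T AT Tfs].
    by apply: flin; rewrite inE gfs orbT.
  apply: fsep => // g; rewrite inE => /orP[/eqP->|/Tfs//].
  by apply/eqP/negPn/negP => fT; apply: f0; exists T.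
have ff : f \in f :: fs by rewrite mem_head.
have [||| n [g [Ag gP]]] := IH [set T | A T /\ f T = 0].
- move=> k S T [AS fS] [AT fT]; split; first exact: Alin.
  by rewrite flin // fS fT mulr0 addr0.
- move=> g k S T gfs [AS _] [AT _].
  by apply: flin => //; rewrite inE gfs orbT.
- move=> T [AT fT] Tfs; apply: fsep => // g.
  by rewrite inE => /orP[/eqP->//|/Tfs].
(* The last slot holds [T0], on which [f] does not vanish; the other slots span the kernel of
   [f]. *)
exists n.+1, (fun i => if unlift ord_max i is Some j then g j else T0); split.
  by move=> i; case: unlift => // j; case: (Ag j).
move=> T AT; pose k := f T / f T0.
have [|c cP] := gP (opadd (opscale (- k) T0) T).
  split; first exact: Alin.
  by rewrite flin // mulNr divfK // addNr.
exists (fun i => if unlift ord_max i is Some j then c j else k) => x.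
rewrite big_ord_recr /= unlift_none.
under eq_bigr => i _.
  rewrite (_ : widen_ord _ i = lift ord_max i) ?liftK; last first.
    by apply: val_inj; rewrite /= /bump leqNgt ltn_ord.
  over.
by rewrite -cP /opadd /opscale scaleNr addrAC addNr add0r.
Qed.

Theorem theorem2p1 (R : realType) (H : lmodType R[i]) (ip : H -> H -> R[i])
  (A : set (op H)) :
  is_hilbert ip -> unital_subalgebra ip A -> has_diagonal ip A -> finite_dim A.
Proof.
move=> hilbP AP /(diagonal_series_exists hilbP AP)[a [b [alpha ds]]].
have [K [l lP]] := finitely_many_coefs_separate hilbP AP ds.
pose fs : seq (op H -> R[i]) :=
  [seq (fun c : op H => ip (c (a i p.1)) p.2) | i <- iota 0 K, p <- l].
apply: (functionals_finite_dim (fs := fs)).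
- by move=> k S T AS AT; apply: (alg_add AP) => //; apply: (alg_scale AP).
- move=> f k S T /allpairsP[[i p] [_ _ ->]] _ _ /=.
  by rewrite /opadd /opscale (ip_linear hilbP.1).
move=> T AT Tfs; apply: lP => // i p iK pl.
apply: (Tfs (fun c : op H => ip (c (a i p.1)) p.2)).
by apply/allpairsP; exists (i, p); rewrite mem_iota.
Qed.
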